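(* There is an absolute constant $k$ such that for every $N,M\ge 1$ and every partial function $f:[M]^N\to\{0,1,\ast\}$ that is permutation-invariant, we have \[ \operatorname{R}(f)=O\!\left(\operatorname{Q}(f)^{9}\,\log^{k}\operatorname{Q}(f)\right), \] i.e. $\operatorname{R}(f)=O(\operatorname{Q}(f)^9\operatorname{polylog}\operatorname{Q}(f))$, where the implied constants are independent of $N$, $M$ and $f$. In particular $\operatorname{R}(f)\le \operatorname{Q}(f)^{O(1)}$ for all such $f$.
   Context: A partial function $f:[M]^N\to\{0,1,\ast\}$ is defined on the set $S=\{X: f(X)\neq\ast\}$ of inputs $X=(x_1,\dots,x_N)\in[M]^N$. An algorithm accesses $X$ only through queries: given $i\in[N]$ it learns $x_i$ (in the quantum case, by the standard unitary query oracle $|i,z\rangle\mapsto|i,z+x_i \bmod M\rangle$). $\operatorname{R}(f)$ is the (bounded-error) randomized query complexity: the expected number of queries made by an optimal randomized algorithm that, for every $X\in S$, outputs $f(X)$ with probability at least $2/3$. $\operatorname{Q}(f)$ is the bounded-error quantum query complexity: the minimum number of queries of a quantum algorithm that outputs $f(X)$ with probability at least $2/3$ for every $X\in S$. $f$ is permutation-invariant if $f(x_1,\dots,x_N)=f(\tau(x_{\sigma(1)}),\dots,\tau(x_{\sigma(N)}))$ for all $X\in[M]^N$, all $\sigma\in S_N$ and all $\tau\in S_M$. *)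

(* Defs.v *)
From HB Require Import structures.
From mathcomp Require Import all_boot all_order all_algebra all_fingroup.
From mathcomp Require Import spectral.
From mathcomp Require Import complex.
From mathcomp Require Import classical_sets reals exp.
From mathcomp Require Import Rstruct.
From Stdlib Require Rdefinitions.

Set Implicit Arguments.
Unset Strict Implicit.
Unset Printing Implicit Defensive.

Import Order.TTheory GRing.Theory Num.Theory.
Local Open Scope ring_scope.
Local Open Scope classical_set_scope.

Notation R := Rdefinitions.R.

Definition input (N M : nat) := {ffun 'I_N -> 'I_M}.

(* Partial Boolean function: None plays the role of the symbol *. *)
Definition pfun (N M : nat) := input N M -> option bool.

Definition in_dom N M (f : pfun N M) (X : input N M) : bool := f X != None.

Definition perm_invariant N M (f : pfun N M) : Prop :=
  forall (sigma : 'S_N) (tau : 'S_M) (X : input N M),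
    f X = f [ffun i => tau (X (sigma i))].

Inductive dtree (N M : nat) : Type :=
| Leaf of bool
| Node of 'I_N & ('I_M -> dtree N M).

Fixpoint dt_out N M (t : dtree N M) (X : input N M) : bool :=
  match t with
  | Leaf b => b
  | Node i k => dt_out (k (X i)) X
  end.

Fixpoint dt_cost N M (t : dtree N M) (X : input N M) : nat :=
  match t with
  | Leaf _ => 0
  | Node i k => (dt_cost (k (X i)) X).+1
  end.

(* A randomized algorithm: a (finitely supported) probability distribution
   over deterministic decision trees, given as a list of (weight, tree). *)
Definition ralg (N M : nat) := seq (R * dtree N M).

Definition is_distr N M (A : ralg N M) : Prop :=
  (forall p, List.In p A -> 0 <= p.1) /\ \sum_(p <- A) p.1 = 1.

Definition r_prob N M (A : ralg N M) (X : input N M) (b : bool) : R :=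
  \sum_(p <- A | dt_out p.2 X == b) p.1.

Definition r_ecost N M (A : ralg N M) (X : input N M) : R :=
  \sum_(p <- A) p.1 * (dt_cost p.2 X)%:R.

Definition r_computes N M (f : pfun N M) (A : ralg N M) : Prop :=
  is_distr A /\
  forall (X : input N M) (b : bool), f X = Some b -> 2 / 3 <= r_prob A X b.

Definition r_cost N M (f : pfun N M) (A : ralg N M) : R :=
  \big[Num.max/0]_(X : input N M | in_dom f X) r_ecost A X.

Definition Rquery N M (f : pfun N M) : R :=
  inf [set c : R | exists A : ralg N M, r_computes f A /\ r_cost f A = c].

Definition C := R[i].

(* computational basis |i, z, w> : query index, query (answer) register, workspace *)
Definition qbasis (N M d : nat) := ('I_N * 'I_M * 'I_d)%type.

Definition qdim N M d := #|{: qbasis N M d}|.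

Definition addM (M : nat) (z x : 'I_M) : 'I_M :=
  Ordinal (ltn_pmod (z + x) (leq_ltn_trans (leq0n z) (ltn_ord z))).

Definition oracle_map N M d (X : input N M) (s : qbasis N M d) : qbasis N M d :=
  let: (i, z, w) := s in (i, addM z (X i), w).

Definition oracle N M d (X : input N M) : 'M[C]_(qdim N M d) :=
  \matrix_(r, c) (enum_val r == oracle_map X (enum_val c))%:R.

Definition basis_vec N M d (s : qbasis N M d) : 'cV[C]_(qdim N M d) :=
  \col_r (enum_val r == s)%:R.

(* A T-query quantum algorithm with workspace dimension d: start in the basis
   state s0, apply U_0, O_X, U_1, O_X, ..., O_X, U_T, measure in the
   computational basis and output g(outcome). *)
Record qalg (N M : nat) (T : nat) := QAlg {
  qa_d : nat;
  qa_s0 : qbasis N M qa_d;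
  qa_U : nat -> 'M[C]_(qdim N M qa_d);
  qa_out : qbasis N M qa_d -> bool
}.
Arguments qa_d {N M T} _.
Arguments qa_s0 {N M T} _.
Arguments qa_U {N M T} _ _.
Arguments qa_out {N M T} _ _.

Fixpoint q_state N M T (A : qalg N M T) (X : input N M) (k : nat)
  : 'cV[C]_(qdim N M (qa_d A)) :=
  match k with
  | 0 => qa_U A 0 *m basis_vec (qa_s0 A)
  | k'.+1 => qa_U A k *m (oracle (qa_d A) X *m q_state A X k')
  end.

Definition q_prob N M T (A : qalg N M T) (X : input N M) (b : bool) : C :=
  \sum_(s : qbasis N M (qa_d A) | qa_out A s == b)
     `|q_state A X T (enum_rank s) 0| ^+ 2.

Definition q_computes N M (f : pfun N M) (T : nat) : Prop :=
  exists A : qalg N M T,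
    (forall k, (k <= T)%N -> qa_U A k \is unitarymx) /\
    forall (X : input N M) (b : bool), f X = Some b ->
      (2 / 3 : C) <= q_prob A X b.

Definition Qquery N M (f : pfun N M) : R :=
  inf [set (T%:R : R) | T in [set T : nat | q_computes f T]].

(* Main.v *)
(* Only invariance under permutations of the input positions is used, and it
   yields R(f) = O(Q(f)^8).  The acceptance probability A of a T-query quantum
   algorithm is a polynomial of degree k = O(T) in the indicators of x_i = v.
   Fix X and consider the mean of A(X o C) for random maps C of the positions.
   - For C a uniform permutation, the mean decides f(X) by invariance.
   - Permutations and uniform maps C are the parameters w = -1 and w = 0 of
     a Polya urn.  Up to an explicit factor, the mean is a polynomial of degree
     k in w which is bounded at all w >= 0, so it changes little between -1 and
     0 when N is at least of order k^4.
   - Take C with independent values drawn from a law mu.  Moving a fraction s of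
     mu from the uniform law to a random atom changes the mean by O(k^4 s^2),
     because the first order effect averages out.  Iterating O(k^8) times moves
     nearly all the mass to O(k^8) random atoms.
   For such a mu, A(X o C) depends on X at the O(k^8) atoms only; the randomized
   algorithm queries these and computes the mean.  All estimates of polynomials
   come from interpolation at the squares 0, 1, 4, ..., k^2. *)

Require Import Defs.
From HB Require Import structures.
From mathcomp Require Import all_boot all_order all_algebra all_fingroup.
From mathcomp Require Import classical_sets reals exp.
From mathcomp Require Import Rstruct.
From mathcomp Require Import spectral complex boolp zify ring lra.
Import Order.TTheory GRing.Theory Num.Theory.
Local Open Scope ring_scope.

Set Implicit Arguments.
Unset Strict Implicit.
Unset Printing Implicit Defensive.

(** * Interpolation at the squares *)

Definition sqdist (i j : nat) : nat := ((j ^ 2 - i ^ 2) + (i ^ 2 - j ^ 2))%N.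

Lemma sqdistE (i j : nat) : (sqdist i j = (j - i + (i - j)) * (i + j))%N.
Proof. by rewrite /sqdist !subn_sqr; nia. Qed.

Lemma sqdistR (F : realFieldType) (i j : nat) :
  `|(j ^ 2)%:R - (i ^ 2)%:R| = (sqdist i j)%:R :> F.
Proof.
rewrite /sqdist; have [h|h] := leqP (i ^ 2) (j ^ 2).
  have -> : (i ^ 2 - j ^ 2 = 0)%N by apply/eqP; rewrite subn_eq0.
  by rewrite addn0 -natrB // ger0_norm.
have -> : (j ^ 2 - i ^ 2 = 0)%N by apply/eqP; rewrite subn_eq0 ltnW.
by rewrite add0n distrC -natrB ?(ltnW h) // ger0_norm.
Qed.

(** The factors $j-i$ multiply to $(j-1)!/(j-n-1)!$ and the factors $j+i$ to $(j+n)!/j!$; the extra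
    $j$ cancels the quotient of $(j-1)!$ and $j!$. *)
Lemma prod_sqdist_lt (j n : nat) : (n < j)%N ->
  ((\prod_(1 <= i < n.+1) sqdist i j) * (j - n.+1)`! * j = (j + n)`!)%N.
Proof.
elim: n => [|n IHn] ltnj.
  by rewrite big_geq // mul1n addn0 subn1; case: j ltnj => // j _; rewrite factS mulnC.
rewrite big_nat_recr //= addnS factS -IHn ?(ltnW ltnj) //.
have -> : (j - n.+1 = (j - n.+2).+1)%N by lia.
rewrite factS sqdistE.
have -> : (n.+1 - j = 0)%N by lia.
have -> : ((j - n.+2).+1 = j - n.+1)%N by lia.
by rewrite addn0; nia.
Qed.

(** This evaluates the Lagrange denominators. The case $n=j$ is the previous lemma; afterwards each
    new index $n+1$ contributes $(n+1-j)(n+1+j)$. *)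
Lemma prod_sqdist (j n : nat) : (0 < j <= n)%N ->
  ((\prod_(1 <= i < n.+1 | i != j) sqdist i j) * (2 * j ^ 2)
     = (n - j)`! * (n + j)`!)%N.
Proof.
case/andP=> j0; elim: n => [|n IHn]; first by case: j j0.
rewrite leq_eqVlt => /predU1P [ejn|ltjn].
  rewrite big_mkcond big_nat_recr //= -big_mkcond /= ejn eqxx muln1.
  have -> : (\prod_(1 <= i < n.+1 | i != n.+1) sqdist i n.+1 =
            \prod_(1 <= i < n.+1) sqdist i n.+1)%N.
    rewrite big_nat_cond [RHS]big_nat_cond; apply: eq_bigl => i.
    by case: ltngtP => //=; lia.
  have := @prod_sqdist_lt n.+1 n (ltnSn n).
  rewrite subnn fact0 muln1 => h.
  have -> : (n.+1 + n.+1 = (n.+1 + n).+1)%N by lia.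
  by rewrite factS -h; nia.
rewrite ltnS in ltjn.
rewrite big_mkcond big_nat_recr //= -big_mkcond /= ifT; last by rewrite neq_ltn ltnS ltjn orbT.
rewrite sqdistE.
have -> : (j - n.+1 = 0)%N by lia.
rewrite subSn // addSn !factS; have := IHn ltjn.
set A := (\prod_(_ <= _ < _ | _) _)%N; set B := (n - j)`!; set D := (n + j)`! => h.
rewrite add0n.
transitivity ((A * (2 * j ^ 2)) * ((n - j).+1 * (n + j).+1))%N; first by ring.
by rewrite h; ring.
Qed.

Lemma fact_sqr_le (j n : nat) : (j <= n)%N -> (n`! * n`! <= (n - j)`! * (n + j)`!)%N.
Proof.
elim: j => [|j IHj] ltjn; first by rewrite subn0 addn0.
apply: leq_trans (IHj (ltnW ltjn)) _.
have -> : (n - j = (n - j.+1).+1)%N by lia.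
rewrite addnS !factS -mulnA [leqRHS]mulnCA leq_mul //; lia.
Qed.

Definition node (F : realFieldType) (j : nat) : F := (j ^ 2)%:R.

Lemma node_inj (F : realFieldType) : injective (node F).
Proof.
by move=> i j /eqP; rewrite /node eqr_nat eqn_sqr => /eqP.
Qed.

(* With the squares 1, 4, ..., n^2 as interpolation nodes, the Lagrange basis
   is bounded on [0, 1] by 2 (n!)^2 / ((n-j)! (n+j)!) <= 2. *)
Definition lagrange_node (F : realFieldType) (n j : nat) : {poly F} :=
  (\prod_(1 <= i < n.+1 | i != j) (node F j - node F i))^-1 *:
    \prod_(1 <= i < n.+1 | i != j) ('X - (node F i)%:P).

Lemma lagrange_node_eq (F : realFieldType) (n j : nat) : (0 < j <= n)%N ->
  (lagrange_node F n j).[node F j] = 1.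
Proof.
move=> jn; rewrite hornerZ horner_prod.
under [X in _ * X]eq_bigr do rewrite hornerXsubC.
rewrite mulVf // prodf_seq_neq0; apply/allP => i _; apply/implyP => ij.
by rewrite subr_eq0; apply: contraNN ij => /eqP /node_inj ->.
Qed.

Lemma lagrange_node_neq (F : realFieldType) (n j l : nat) : (0 < l <= n)%N ->
  l != j -> (lagrange_node F n j).[node F l] = 0.
Proof.
move=> ln lj; rewrite hornerZ horner_prod.
have : \prod_(1 <= i < n.+1 | i != j) ('X - (node F i)%:P).[node F l] == 0.
  rewrite prodf_seq_eq0; apply/hasP; exists l; first by rewrite mem_index_iota ltnS.
  by rewrite lj hornerXsubC subrr /=.
by move/eqP->; rewrite mulr0.
Qed.

Lemma size_lagrange_node (F : realFieldType) (n j : nat) : (0 < j <= n)%N ->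
  (size (lagrange_node F n j) <= n)%N.
Proof.
move=> jn; apply: leq_trans (size_scale_leq _ _) _.
rewrite -big_filter size_prod_XsubC size_filter.
have := count_predC (fun i => i != j) (index_iota 1 n.+1).
rewrite size_iota subSS subn0 => {2}<-.
rewrite -addn1 leq_add2l -has_count; apply/hasP; exists j; last by rewrite /= negbK.
by rewrite mem_index_iota ltnS.
Qed.

Lemma lagrange_node_le2 (F : realFieldType) (n j : nat) (x : F) :
  (0 < j <= n)%N -> 0 <= x <= 1 -> `|(lagrange_node F n j).[x]| <= 2.
Proof.
move=> /[dup] jn /andP[j0 jlen] /andP[x0 x1]; rewrite hornerZ horner_prod normrM normfV.
rewrite !normr_prod.
under eq_bigr do rewrite sqdistR.
under [X in _ * X]eq_bigr do rewrite hornerXsubC.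
have hS := prod_sqdist jn.
rewrite -natr_prod.
set S := (\prod_(_ <= _ < _ | _) _)%N in hS *.
have S0 : (0 < S)%N.
  have : (0 < S * (2 * j ^ 2))%N by rewrite hS muln_gt0 !fact_gt0.
  by rewrite muln_gt0 => /andP[].
rewrite mulrC ler_pdivrMr ?ltr0n //.
(* On $[0,1]$ each factor $|x-i^2|$ is at most $i^2$, so the numerator is at most $(n!)^2/j^2$,
   against the denominator $(n-j)!(n+j)!/(2j^2)$. *)
have hle : \prod_(1 <= i < n.+1 | i != j) `|x - node F i| <=
           (\prod_(1 <= i < n.+1 | i != j) (i ^ 2))%N%:R.
  rewrite natr_prod big_nat_cond [leRHS]big_nat_cond; apply: ler_prod => i /andP[/andP[i1 _] _].
  rewrite normr_ge0 /= ler0_norm.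
    by rewrite opprB lerBlDr /node lerDl.
  by rewrite subr_le0 (le_trans x1) // /node ler1n expn_gt0 i1.
apply: le_trans hle _; rewrite -natrM ler_nat.
have hP : (\prod_(1 <= i < n.+1 | i != j) (i ^ 2) * j ^ 2 = n`! * n`!)%N.
  rewrite mulnn fact_prod (big_morph _ (fun a b => expnMn a b 2) (exp1n 2)).
  rewrite (bigD1_seq j) ?iota_uniq //=; last first.
    by rewrite mem_index_iota ltnS.
  by rewrite mulnC.
have := fact_sqr_le jlen.
rewrite -hP -hS mulnCA mulnA => h.
by rewrite -(leq_pmul2r (m := j ^ 2)) ?expn_gt0 ?j0.
Qed.

Lemma le_sum_nodes (F : realFieldType) (n : nat) (g : {poly F}) (x : F) :
  (size g <= n)%N -> 0 <= x <= 1 ->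
  `|g.[x]| <= 2 * \sum_(1 <= j < n.+1) `|g.[node F j]|.
Proof.
move=> sg x01.
have interp : g = \sum_(1 <= j < n.+1) g.[node F j] *: lagrange_node F n j.
  apply/eqP; rewrite -subr_eq0; set p := g - _.
  have sp : (size p <= n)%N.
    rewrite (leq_trans (size_polyD _ _)) // geq_max sg size_polyN.
    rewrite (leq_trans (size_sum _ _ _)) // big_nat_cond.
    elim/big_ind: _ => // [a b an bn|j]; first by rewrite geq_max an bn.
    rewrite andbT ltnS => jn.
    by rewrite (leq_trans (size_scale_leq _ _)) // size_lagrange_node.
  (* A nonzero [p] vanishing at all $n$ nodes would have size greater than $n$. *)
  apply: contraTT sp => p0; rewrite -ltnNge.
  rewrite -[n in (n < _)%N](size_iota 1) -(size_map (node F)).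
  apply: max_poly_roots => //; last by rewrite map_inj_uniq ?iota_uniq //; apply: node_inj.
  apply/allP => _ /mapP[l + ->]; rewrite mem_iota add1n ltnS => ln.
  rewrite rootE hornerD hornerN horner_sum (bigD1_seq l) ?iota_uniq //=; last first.
    by rewrite mem_index_iota ltnS.
  rewrite hornerZ lagrange_node_eq // mulr1 big1 ?addr0 ?subrr // => i il.
  by rewrite hornerZ lagrange_node_neq ?mulr0 // eq_sym.
rewrite [in leLHS]interp horner_sum mulr_sumr.
apply: le_trans (ler_norm_sum _ _ _) _.
rewrite big_nat_cond [leRHS]big_nat_cond; apply: ler_sum => j; rewrite andbT ltnS => jn.
by rewrite hornerZ normrM mulrC ler_wpM2r // lagrange_node_le2.
Qed.

(** Comparison with a telescoping series: the induction carries the stronger bound $2-1/(n+1)$ for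
    $n+1$ terms. *)
Lemma sum_inv_node_le2 (F : realFieldType) (n : nat) :
  \sum_(1 <= j < n.+1) (node F j)^-1 <= 2.
Proof.
suff : \sum_(1 <= j < n.+2) (node F j)^-1 <= 2 - n.+1%:R^-1.
  rewrite big_nat_recr //= => h; apply: le_trans (_ : _ <= 2 - n.+1%:R^-1) _.
    by apply: le_trans h; rewrite lerDl invr_ge0 ler0n.
  by rewrite gerBl invr_ge0 ler0n.
elim: n => [|n IHn].
  by rewrite big_nat1 /node exp1n invr1; lra.
rewrite big_nat_recr //=; apply: le_trans (lerD IHn (lexx _)) _.
rewrite /node natrX -[n.+2%:R]natr1.
have : 0 < n.+1%:R :> F by rewrite ltr0n.
move: (n.+1%:R : F) => a a0.
have a1 : 0 < a + 1 by lra.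
have h : 2 - (a + 1)^-1 - (2 - a^-1 + (a + 1) ^- 2) = (a * (a + 1) ^+ 2)^-1.
  by field; rewrite !gt_eqF.
have : 0 <= (a * (a + 1) ^+ 2)^-1 by rewrite invr_ge0 mulr_ge0 ?sqr_ge0 ?ltW.
by rewrite -h subr_ge0.
Qed.

(* Dividing q - q(0) by X^d gains a factor j^-2d at the node j^2, which makes
   the sum over the nodes converge. *)
Lemma le_bounded_at_nodes (F : realFieldType) (n d : nat) (q : {poly F}) (b x : F) :
  (size q <= n.+1)%N -> (0 < d)%N ->
  (forall i, (0 < i < d)%N -> q`_i = 0) ->
  (forall j, (j <= n)%N -> 0 <= q.[node F j] <= b) -> 0 <= x <= 1 ->
  `|q.[x] - q.[0]| <= 4 * b * x ^+ d.
Proof.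
move=> sq d0 qd qb /andP[x0 x1].
have b0 : 0 <= b by have /andP[] := qb 0 (leq0n _); apply: le_trans.
have q0 : 0 <= q.[0] <= b by have := qb 0 (leq0n _); rewrite /node.
pose g := drop_poly d q.
have qE : q = (q.[0])%:P + g * 'X^d.
  rewrite -{1}(poly_take_drop d q); congr (_ + _).
  apply/polyP => i; rewrite coef_take_poly coefC horner_coef0.
  by case: i => [|i]; rewrite ?d0 //=; case: ifP => // h; rewrite qd.
have gE y : q.[y] - q.[0] = g.[y] * y ^+ d.
  by rewrite {1}qE hornerD hornerC hornerM hornerXn addrC addKr.
have sg : (size g <= n)%N by rewrite size_drop_poly; lia.
rewrite gE normrM [ `|_ ^+ d|]ger0_norm ?exprn_ge0 // ler_wpM2r ?exprn_ge0 //.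
apply: le_trans (le_sum_nodes sg _) _; first by rewrite x0.
have -> : 4 * b = 2 * (b * 2) :> F by ring.
rewrite ler_wpM2l //.
apply: le_trans (_ : _ <= \sum_(1 <= j < n.+1) (b * (node F j)^-1)) _; last first.
  by rewrite -mulr_sumr ler_wpM2l // sum_inv_node_le2.
rewrite big_nat_cond [leRHS]big_nat_cond; apply: ler_sum => j; rewrite andbT ltnS => /andP[j1 jn].
have nj0 : 0 < node F j by rewrite ltr0n expn_gt0 j1.
have nj1 : 1 <= node F j by rewrite ler1n expn_gt0 j1.
rewrite ler_pdivlMr //.
apply: (@le_trans _ _ `|g.[node F j] * node F j ^+ d|).
  rewrite normrM [ `|_ ^+ d|]ger0_norm; last by rewrite exprn_ge0 // ltW.
  rewrite ler_wpM2l //.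
  by rewrite -[leLHS]expr1 ler_weXn2l.
rewrite -gE ler_norml; have /andP[? ?] := qb j jn; have /andP[? ?] := q0.
by apply/andP; split; lra.
Qed.

(** * Functions of low degree and independent sampling *)

Definition mon (I V : finType) (l : seq (I * V)) (C : {ffun I -> V}) : bool :=
  all (fun p => C p.1 == p.2) l.

(** Polynomial degree in the indicators of [C i = v]. The monomials may contain repeated or
    conflicting pairs, so that a product is plain concatenation. *)
Definition degle (K : comNzRingType) (I V : finType) (k : nat)
    (A : {ffun I -> V} -> K) : Prop :=
  exists s : seq (K * seq (I * V)),
    all (fun t => size t.2 <= k)%N s /\
    forall C, A C = \sum_(t <- s) t.1 * (mon t.2 C)%:R.

Lemma eq_degle (K : comNzRingType) (I V : finType) (k : nat)
    (A B : {ffun I -> V} -> K) : A =1 B -> degle k A -> degle k B.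
Proof. by move=> AB [s [hs sE]]; exists s; split=> // C; rewrite -AB. Qed.

Lemma degleW (K : comNzRingType) (I V : finType) (k m : nat)
    (A : {ffun I -> V} -> K) : (k <= m)%N -> degle k A -> degle m A.
Proof.
move=> km [s [hs sE]]; exists s; split=> //.
by apply: sub_all hs => t /leq_trans ->.
Qed.

Lemma degle_mon (K : comNzRingType) (I V : finType) (c : K) (l : seq (I * V)) :
  degle (size l) (fun C => c * (mon l C)%:R).
Proof. by exists [:: (c, l)]; split=> [|C]; rewrite /= ?leqnn // big_seq1. Qed.

Lemma degle_const (K : comNzRingType) (I V : finType) (k : nat) (c : K) :
  degle k (fun _ : {ffun I -> V} => c).
Proof.
apply: (degleW (leq0n k)); apply: eq_degle (degle_mon c [::]) => C.
by rewrite mulr1.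
Qed.

Lemma degle_add (K : comNzRingType) (I V : finType) (k : nat)
    (A B : {ffun I -> V} -> K) :
  degle k A -> degle k B -> degle k (fun C => A C + B C).
Proof.
move=> [s [hs sE]] [t [ht tE]]; exists (s ++ t); split; first by rewrite all_cat hs.
by move=> C; rewrite big_cat sE tE.
Qed.

Lemma degle_sum (K : comNzRingType) (I V : finType) (k : nat) (J : eqType)
    (r : seq J) (P : pred J) (A : J -> {ffun I -> V} -> K) :
  (forall j, j \in r -> P j -> degle k (A j)) ->
  degle k (fun C => \sum_(j <- r | P j) A j C).
Proof.
elim: r => [|j r IHr] h.
  by apply: eq_degle (degle_const _ _ k 0) => C; rewrite big_nil.
have {}IHr := IHr (fun i ir => h i (mem_behead (s := j :: r) ir)).
have [Pj|nPj] := boolP (P j).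
  apply: eq_degle (degle_add (h j (mem_head _ _) Pj) IHr) => C.
  by rewrite big_cons Pj.
by apply: eq_degle IHr => C; rewrite big_cons (negPf nPj).
Qed.

Lemma degle_mul (K : comNzRingType) (I V : finType) (k m : nat)
    (A B : {ffun I -> V} -> K) :
  degle k A -> degle m B -> degle (k + m) (fun C => A C * B C).
Proof.
move=> [s [/allP hs sE]] [t [/allP ht tE]].
apply: (@eq_degle _ _ _ _ (fun C => \sum_(p <- s) \sum_(q <- t)
    (p.1 * q.1) * (mon (p.2 ++ q.2) C)%:R)).
  move=> C; rewrite sE tE mulr_suml; apply: eq_bigr => p _.
  rewrite mulr_sumr; apply: eq_bigr => q _.
  by rewrite /mon all_cat -mulnb natrM mulrACA.
apply: degle_sum => p ps _; apply: degle_sum => q qt _.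
apply: degleW (degle_mon _ _); rewrite size_cat.
by apply: leq_add; [apply: hs | apply: ht].
Qed.

Lemma degle_eval (K : comNzRingType) (I V : finType) (i : I) (v : V) :
  degle 1 (fun C : {ffun I -> V} => (C i == v)%:R : K).
Proof.
apply: eq_degle (degle_mon 1 [:: (i, v)]) => C.
by rewrite /mon /= andbT mul1r.
Qed.

(** The indicator of [X (C i) = v] is the sum of the indicators of [C i = u] over the fibre of [X]
    above [v], hence still of degree 1. *)
Lemma degle_comp (K : comNzRingType) (I V M : finType) (k : nat)
    (X : {ffun V -> M}) (A : {ffun I -> M} -> K) :
  degle k A -> degle k (fun C : {ffun I -> V} => A [ffun i => X (C i)]).
Proof.
move=> [s [/allP hs sE]].
apply: (@eq_degle _ _ _ _ (fun C => \sum_(t <- s)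
    t.1 * (mon t.2 [ffun i => X (C i)])%:R)); first by move=> C; rewrite sE.
apply: degle_sum => t ts _; apply: (degleW (hs t ts)).
apply: (@degle_mul _ _ _ 0%N _ (fun=> t.1)); first exact: degle_const.
elim: t.2 => [|[i v] l IHl].
  by apply: eq_degle (degle_const _ _ 0 1) => C.
apply: (@eq_degle _ _ _ _ (fun C => (\sum_(u | X u == v) (C i == u)%:R) *
    (mon l [ffun i => X (C i)])%:R)).
  move=> C; rewrite /= -mulnb natrM; congr (_ * _); rewrite ffunE.
  case: eqP => h; last first.
    by rewrite big1 // => u /eqP Xu; case: eqP => // e; case: h; rewrite e.
  rewrite (bigD1 (C i)) /=; last by rewrite h.
  by rewrite eqxx big1 ?addr0 // => u /andP[_ /negPf]; rewrite eq_sym => ->.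
apply: (@degle_mul _ _ _ 1%N) IHl.
by apply: degle_sum => u _ _; apply: degle_eval.
Qed.

(** Additivity suffices because monomials only take the values 0 and 1. This covers both complex
    conjugation and the real part. *)
Lemma degle_map (K L : comNzRingType) (I V : finType) (k : nat) (f : K -> L)
    (A : {ffun I -> V} -> K) : f 0 = 0 -> {morph f : x y / x + y} ->
  degle k A -> degle k (fun C => f (A C)).
Proof.
move=> f0 fD [s [hs sE]]; exists [seq (f t.1, t.2) | t <- s]; split; first by rewrite all_map.
move=> C; rewrite sE (big_morph f fD f0) big_map; apply: eq_bigr => t _ /=.
by case: (mon _ _); rewrite ?mulr1 // !mulr0.
Qed.

(** * Means under product laws, and their variation along lines of laws *)

Definition expect (F : realFieldType) (I V : finType) (A : {ffun I -> V} -> F)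
  (mu : V -> F) : F := \sum_C A C * \prod_i mu (C i).

Definition is_prob (F : realFieldType) (V : finType) (mu : V -> F) : Prop :=
  (forall v, 0 <= mu v) /\ \sum_v mu v = 1.

Lemma expect_bounds (F : realFieldType) (I V : finType) (A : {ffun I -> V} -> F) mu :
  (forall C, 0 <= A C <= 1) -> is_prob mu -> 0 <= expect A mu <= 1.
Proof.
move=> A01 [mu0 mu1]; apply/andP; split.
  apply: sumr_ge0 => C _; apply: mulr_ge0; first by case/andP: (A01 C).
  by apply: prodr_ge0.
apply: (@le_trans _ _ (\sum_(C : {ffun I -> V}) \prod_i mu (C i))).
  apply: ler_sum => C _; rewrite ler_piMl ?prodr_ge0 //.
  by case/andP: (A01 C).
rewrite -(bigA_distr_bigA (fun _ : I => mu)).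
by rewrite big1.
Qed.

Lemma eq_expect (F : realFieldType) (I V : finType) (A : {ffun I -> V} -> F) mu nu :
  mu =1 nu -> expect A mu = expect A nu.
Proof.
move=> h; apply: eq_bigr => C _; congr (_ * _).
by apply: eq_bigr => i _; rewrite h.
Qed.

(** The contribution of coordinate [i] to the mean of the monomial [l] under the law $a+bX$: the
    mass of the values that satisfy every constraint of [l] at [i]. *)
Definition line_factor (F : realFieldType) (I V : finType) (l : seq (I * V))
    (a b : V -> F) (i : I) : {poly F} :=
  \sum_(v | all (fun p => (p.1 == i) ==> (v == p.2)) l) ((a v)%:P + b v *: 'X).

Definition line_poly (F : realFieldType) (I V : finType)
    (s : seq (F * seq (I * V))) (a b : V -> F) : {poly F} :=
  \sum_(t <- s) t.1 *: \prod_i line_factor t.2 a b i.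

Lemma horner_line_poly (F : realFieldType) (I V : finType)
    (s : seq (F * seq (I * V))) (A : {ffun I -> V} -> F) a b x :
  (forall C, A C = \sum_(t <- s) t.1 * (mon t.2 C)%:R) ->
  (line_poly s a b).[x] = expect A (fun v => a v + b v * x).
Proof.
move=> sE; rewrite /expect.
under eq_bigr do rewrite sE mulr_suml.
rewrite exchange_big horner_sum; apply: eq_bigr => t _ /=.
rewrite hornerZ horner_prod.
under eq_bigr do rewrite horner_sum big_mkcond.
rewrite bigA_distr_bigA mulr_sumr; apply: eq_bigr => C _.
rewrite -mulrA; congr (_ * _).
have [mC|/allPn [[i v] /= tl Civ]] := boolP (mon t.2 C).
  rewrite mul1r; apply: eq_bigr => i _; rewrite ifT.
    by rewrite hornerD hornerC hornerZ hornerX.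
  by apply: sub_all mC => p h; apply/implyP => /eqP <-.
rewrite mul0r (bigD1 i) //= ifF ?mul0r //.
by apply/negbTE/allPn; exists (i, v) => //=; rewrite eqxx.
Qed.

(** A coordinate absent from the monomial contributes $\sum a+X\sum b=1$; each of the at most $k$
    others contributes an affine factor. *)
Lemma size_line_poly (F : realFieldType) (I V : finType) (k : nat)
    (s : seq (F * seq (I * V))) (a b : V -> F) :
  all (fun t => size t.2 <= k)%N s -> \sum_v a v = 1 -> \sum_v b v = 0 ->
  (size (line_poly s a b) <= k.+1)%N.
Proof.
move=> /allP hs a1 b0; rewrite /line_poly big_seq.
elim/big_ind: _ => [|p q hp hq|t ts]; first by rewrite size_poly0.
  by rewrite (leq_trans (size_polyD _ _)) // geq_max hp.
rewrite (leq_trans (size_scale_leq _ _)) //.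
rewrite (bigID (mem (map fst t.2))) /= [X in _ * X]big1 ?mulr1; last first.
  move=> i il; rewrite /line_factor (eq_bigl xpredT).
    rewrite big_split /= -scaler_suml b0 scale0r addr0 -rmorph_sum a1.
    by rewrite rmorph1.
  move=> v; apply/allP => p pl; apply/implyP => /eqP e.
  by move: il; rewrite -e map_f.
apply: leq_trans (size_poly_prod_leq _ _) _.
have h2 : (\sum_(i in mem (map fst t.2)) size (line_factor t.2 a b i) <=
          \sum_(i in mem (map fst t.2)) 2)%N.
  apply: leq_sum => i _; rewrite /line_factor.
  elim/big_ind: _ => [|p q hp hq|v _]; first by rewrite size_poly0.
    by rewrite (leq_trans (size_polyD _ _)) // geq_max hp.
  rewrite (leq_trans (size_polyD _ _)) // geq_max size_polyC.
  rewrite (leq_trans (size_scale_leq _ _)) ?size_polyX // andbT.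
  by case: eqP.
rewrite sum_nat_const in h2.
have h3 : (#|mem (map fst t.2)| <= size t.2)%N.
  by rewrite -(size_map fst) card_size.
have h4 := hs t ts; rewrite leq_subLR.
apply: leq_trans (_ : (#|mem [seq i.1 | i <- t.2]| * 2).+1 <= _)%N; first by rewrite ltnS.
by rewrite muln2 -addnn addnS ltnS; exact: leq_add (leqnn _) (leq_trans h3 h4).
Qed.

(** The constant coefficient does not depend on the direction and the first one is linear in it, so
    directions with sum zero cancel. Both facts are carried together through the product over
    coordinates. *)
Lemma line_poly_coef1 (F : realFieldType) (I V Y : finType)
    (s : seq (F * seq (I * V))) (a : V -> F) (b : Y -> V -> F) :
  (forall v, \sum_y b y v = 0) -> \sum_y (line_poly s a (b y))`_1 = 0.
Proof.
move=> b0; under eq_bigr do rewrite coef_sum.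
rewrite exchange_big big1 //= => t _; under eq_bigr do rewrite coefZ.
rewrite -mulr_sumr; apply/eqP; rewrite mulf_eq0; apply/orP; right; apply/eqP.
have c0 y i : (line_factor t.2 a (b y) i)`_0 = (line_factor t.2 a (fun=> 0) i)`_0.
  rewrite !coef_sum; apply: eq_bigr => v _.
  by rewrite !coefD !coefZ !coefX !mulr0.
have c1 i : \sum_y (line_factor t.2 a (b y) i)`_1 = 0.
  under eq_bigr do rewrite coef_sum.
  rewrite exchange_big big1 // => v _; under eq_bigr do rewrite coefD coefC coefZ coefX mulr1 add0r.
  exact: b0.
suff [_ ->] : (forall y, (\prod_i line_factor t.2 a (b y) i)`_0 =
     (\prod_i line_factor t.2 a (fun=> 0) i)`_0) /\
   \sum_y (\prod_i line_factor t.2 a (b y) i)`_1 = 0 by [].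
elim: (index_enum I) => [|i r [IH0 IH1]].
  split=> [y|]; first by rewrite !big_nil.
  by apply: big1 => y _; rewrite big_nil coef1.
split=> [y|]; first by rewrite !big_cons !coef0M c0 IH0.
under eq_bigr do rewrite big_cons coefM !big_ord_recl big_ord0 /= addr0 subn0 /bump /= c0 IH0.
by rewrite big_split /= -mulr_sumr -mulr_suml IH1 c1 mulr0 mul0r addr0.
Qed.

(** After dividing the parameter by $k^2$, the nodes $0,1,\dots,k^2$ fall in $[0,1]$, where $a+tb_y$
    is a convex combination of two laws; the summed means then lie in $[0,|Y|]$ at all nodes and
    [le_bounded_at_nodes] applies. Directions with sum zero kill the linear term and allow $d=2$. *)
Lemma expect_line_bound (F : realFieldType) (I V Y : finType) (k d : nat)
    (A : {ffun I -> V} -> F) (a : V -> F) (b : Y -> V -> F) (x : F) :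
  degle k A -> (0 < k)%N -> (forall C, 0 <= A C <= 1) ->
  is_prob a -> (forall y, is_prob (fun v => a v + b y v)) ->
  d = 1%N \/ d = 2%N /\ (forall v, \sum_y b y v = 0) ->
  0 <= x -> k%:R ^+ 2 * x <= 1 ->
  `|\sum_y expect A (fun v => a v + b y v * x) - #|Y|%:R * expect A a|
    <= 4 * #|Y|%:R * (k%:R ^+ 2 * x) ^+ d.
Proof.
move=> [s [hs sE]] k0 A01 [a0 a1] ab hd x0 x1.
have kF : (k%:R ^+ 2 : F) != 0 by rewrite expf_neq0 // pnatr_eq0 -lt0n.
have k2 : 0 < (k%:R ^+ 2 : F) by rewrite exprn_gt0 // ltr0n.
have bs y : \sum_v b y v = 0.
  by apply: (addrI 1); rewrite -{1}a1 -big_split addr0; case: (ab y).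
pose q := \sum_y line_poly s a (fun v => b y v / k%:R ^+ 2).
have qE t : q.[t] = \sum_y expect A (fun v => a v + b y v * (t / k%:R ^+ 2)).
  rewrite horner_sum; apply: eq_bigr => y _; rewrite (horner_line_poly _ _ _ sE).
  by apply: eq_expect => v; rewrite mulrAC mulrA.
have q0 : q.[0] = #|Y|%:R * expect A a.
  rewrite qE (eq_bigr (fun=> expect A a)); first by rewrite sumr_const mulr_natl.
  by move=> y _; apply: eq_expect => v; rewrite mul0r mulr0 addr0.
have qx : q.[k%:R ^+ 2 * x] = \sum_y expect A (fun v => a v + b y v * x).
  rewrite qE; apply: eq_bigr => y _; apply: eq_expect => v.
  by rewrite [_ * x]mulrC mulfK.
rewrite -q0 -qx; apply: (@le_bounded_at_nodes _ k) => //.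
- rewrite /q; elim/big_ind: _ => [|p r hp hr|y _]; first by rewrite size_poly0.
    by rewrite (leq_trans (size_polyD _ _)) // geq_max hp.
  by apply: size_line_poly => //; rewrite -mulr_suml bs mul0r.
- by case: hd => [->|[-> _]].
- move=> i; case: hd => [->|[-> b0]]; first by case: i.
  case: i => [|[|]] // _; rewrite coef_sum line_poly_coef1 // => v.
  by rewrite -mulr_suml b0 mul0r.
- move=> j jk; rewrite qE.
  have t01 : 0 <= node F j / k%:R ^+ 2 <= 1.
    by rewrite divr_ge0 ?ler0n ?(ltW k2) //= ler_pdivrMr // mul1r -natrX ler_nat leq_exp2r.
  set t := _ / _ in t01 *; case/andP: t01 => t0 t1.
  have E01 y : 0 <= expect A (fun v => a v + b y v * t) <= 1.
    apply: expect_bounds => //; split=> [v|]; last first.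
      by rewrite big_split /= -mulr_suml bs mul0r addr0.
    have := a0 v; have [/(_ v) + _] := ab y => h1 h2.
    have -> : a v + b y v * t = (1 - t) * a v + t * (a v + b y v) by ring.
    by rewrite addr_ge0 // mulr_ge0 // subr_ge0.
  apply/andP; split; first by apply: sumr_ge0 => y _; case/andP: (E01 y).
  rewrite -sum1_card natr_sum; apply: ler_sum => y _; by case/andP: (E01 y).
- by rewrite x1 andbT mulr_ge0 // ltW.
Qed.

(** * Stick-breaking laws with uniformly random atoms *)

Fixpoint stick (F : realFieldType) (V : finType) (s : F) (y : seq V) (rho : V -> F)
    : V -> F :=
  match y with
  | [::] => rho
  | w :: y' => fun v => s * (v == w)%:R + (1 - s) * stick s y' rho v
  end.

Definition uniform (F : realFieldType) (V : finType) (_ : V) : F := #|V|%:R^-1.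
Arguments uniform F {V}.

Fixpoint words (V : finType) (J : nat) : seq (seq V) :=
  if J is J'.+1 then [seq w :: y | w <- enum V, y <- words V J'] else [:: [::]].

Lemma size_words (V : finType) (J : nat) y : y \in words V J -> size y = J.
Proof.
elim: J y => [|J IHJ] y /=; first by rewrite inE => /eqP ->.
by case/allpairsP=> -[w z] [_ /= zJ ->] /=; rewrite (IHJ z).
Qed.

Definition avg (F : realFieldType) (V : finType) (J : nat) (f : seq V -> F) : F :=
  (\sum_(y <- words V J) f y) / #|V|%:R ^+ J.

Lemma avgS (F : realFieldType) (V : finType) (J : nat) (f : seq V -> F) :
  avg J.+1 f = (\sum_w avg J (fun y => f (w :: y))) / #|V|%:R.
Proof.
rewrite /avg /= big_allpairs_dep -mulr_suml exprS invfM mulrA mulrAC; congr (_ * _ / _).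
by rewrite big_enum.
Qed.

Lemma avg1 (F : realFieldType) (V : finType) (J : nat) :
  (0 < #|V|)%N -> avg J (fun _ : seq V => 1) = 1 :> F.
Proof.
move=> V0; have V0F : (#|V|%:R : F) != 0 by rewrite pnatr_eq0 -lt0n.
elim: J => [|J IHJ]; first by rewrite /avg big_seq1 expr0 divr1.
rewrite avgS; under eq_bigr do rewrite IHJ.
by rewrite sumr_const -mulr_natl mulr1 divff.
Qed.

Lemma is_prob_uniform (F : realFieldType) (V : finType) :
  (0 < #|V|)%N -> is_prob (uniform F : V -> F).
Proof.
move=> V0; split=> [v|]; first by rewrite invr_ge0 ler0n.
by rewrite sumr_const -[LHS]mulr_natl divff // pnatr_eq0 -lt0n.
Qed.

Lemma sum_delta (F : realFieldType) (V : finType) (w : V) :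
  \sum_v (v == w)%:R = 1 :> F.
Proof.
rewrite (bigD1 w) //= eqxx big1 ?addr0 // => v /negPf ->; exact: erefl.
Qed.

(* Averaging over the new atom cancels the first order effect of moving a
   fraction s of the remaining uniform mass, hence the square. *)
Lemma stick_approx (F : realFieldType) (I V : finType) (k J : nat)
    (A : {ffun I -> V} -> F) (s m : F) (a : V -> F) :
  (0 < #|V|)%N -> degle k A -> (0 < k)%N -> (forall C, 0 <= A C <= 1) ->
  0 <= s -> k%:R ^+ 2 * s <= 1 ->
  (forall v, 0 <= a v) -> 0 <= m -> \sum_v a v + m = 1 ->
  `|avg J (fun y => expect A (fun v => a v + m * stick s y (uniform F) v))
    - expect A (fun v => a v + m * uniform F v)|
   <= J%:R * (4 * (k%:R ^+ 2 * s) ^+ 2).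
Proof.
move=> V0 hA k0 A01 s0 sk.
have s1 : s <= 1.
  apply: le_trans sk; rewrite -[leLHS]mul1r ler_wpM2r // -natrX ler1n expn_gt0.
  by rewrite k0.
set e := 4 * _.
have V0F : (0 : F) < #|V|%:R by rewrite ltr0n.
have [u0 u1] := is_prob_uniform F V0.
(* The fixed part [a] and the unbroken mass [m] vary in the induction, since the first atom joins
   [a] and leaves mass $m(1-s)$. *)
elim: J a m => [|J IHJ] a m a0 m0 am.
  by rewrite /avg big_seq1 expr0 divr1 subrr normr0 mul0r.
rewrite avgS.
set R0 := expect A _.
(* The intermediate mean: [w] is broken off and the rest of the stick is still uniform. [hT] bounds
   the later atoms by induction, [hS] the effect of averaging over [w]. *)
pose T w := expect A (fun v => (a v + m * s * (v == w)%:R) + m * (1 - s) * uniform F v).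
have hT w : `|avg J (fun y => expect A (fun v => a v + m * stick s (w :: y) (uniform F) v)) - T w|
     <= J%:R * e.
  have := IHJ (fun v => a v + m * s * (v == w)%:R) (m * (1 - s)).
  set B := avg J _; set B' := avg J _ => h.
  have -> : B' = B.
    congr (_ / _); apply: eq_bigr => y _; apply: eq_expect => v /=; ring.
  apply: h.
  - by move=> v; rewrite addr_ge0 // !mulr_ge0.
  - by rewrite mulr_ge0 // subr_ge0.
  - rewrite big_split /= -mulr_sumr sum_delta -[RHS]am; ring.
(* The directions $m(\delta_w-\mathrm{uniform})$ sum to zero over $w$, so the case $d=2$ applies. *)
have hS : `|\sum_w T w - #|V|%:R * R0| <= 4 * #|V|%:R * (k%:R ^+ 2 * s) ^+ 2.
  have := @expect_line_bound F I V V k 2 A (fun v => a v + m * uniform F v)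
    (fun w v => m * ((v == w)%:R - uniform F v)) s hA k0 A01.
  set S := \sum_y _ => h.
  have -> : \sum_w T w = S.
    apply: eq_bigr => w _; apply: eq_expect => v; ring.
  apply: h => //.
  - split=> [v|]; first by rewrite addr_ge0 // mulr_ge0.
    by rewrite big_split /= -mulr_sumr u1 mulr1.
  - move=> w; split=> [v|].
      rewrite -addrA -mulrDr addrCA subrr addr0 addr_ge0 // mulr_ge0 //.
    rewrite !big_split /= -!mulr_sumr sumrB sum_delta u1 subrr mulr0 addr0 mulr1.
    exact: am.
  - right; split=> // v; rewrite -mulr_sumr sumrB.
    under eq_bigr do rewrite eq_sym.
    by rewrite sum_delta (u1 : \sum_(w : V) uniform F v = 1) subrr mulr0.
have -> : J.+1%:R * e = J%:R * e + e by rewrite -natr1 mulrDl mul1r.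
set U := \sum_w _.
have -> : U / #|V|%:R - R0 = ((U - \sum_w T w) + (\sum_w T w - #|V|%:R * R0)) / #|V|%:R.
  by field; rewrite gt_eqF.
rewrite normrM normfV (gtr0_norm V0F) ler_pdivrMr // mulrDl.
apply: le_trans (ler_normD _ _) _; apply: lerD; last first.
  by rewrite [e * _]mulrC mulrCA mulrA.
rewrite -sumrB; apply: le_trans (ler_norm_sum _ _ _) _.
apply: le_trans (_ : _ <= \sum_(w : V) J%:R * e) _; first by apply: ler_sum => w _.
by rewrite sumr_const -[leLHS]mulr_natr.
Qed.

Lemma stick_split (F : realFieldType) (V : finType) (s : F) (y : seq V) rho v :
  stick s y rho v = stick s y (fun=> 0) v + (1 - s) ^+ size y * rho v.
Proof.
elim: y => [|w y IHy] /=; first by rewrite expr0 mul1r add0r.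
by rewrite IHy exprS; ring.
Qed.

Lemma stick0_ge0 (F : realFieldType) (V : finType) (s : F) (y : seq V) v :
  0 <= s <= 1 -> 0 <= stick s y (fun=> 0) v.
Proof.
case/andP=> s0 s1; elim: y => [|w y IHy] //=.
by rewrite addr_ge0 ?mulr_ge0 // subr_ge0.
Qed.

Lemma sum_stick0 (F : realFieldType) (V : finType) (s : F) (y : seq V) :
  \sum_v stick s y (fun=> 0) v = 1 - (1 - s) ^+ size y.
Proof.
elim: y => [|w y IHy] /=; first by rewrite big1 // expr0 subrr.
by rewrite big_split /= -!mulr_sumr sum_delta IHy exprS; ring.
Qed.

Lemma stick0_notin (F : realFieldType) (V : finType) (s : F) (y : seq V) v :
  v \notin y -> stick s y (fun=> 0) v = 0.
Proof.
elim: y => [|w y IHy] //=; rewrite inE negb_or => /andP[/negPf -> vy].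
by rewrite IHy // !mulr0 addr0.
Qed.

(** The atomic part of the broken stick, with the leftover mass discarded and the rest
    renormalised. *)
Definition stick_law (F : realFieldType) (V : finType) (s : F) (y : seq V) (v : V) : F :=
  stick s y (fun=> 0) v / (1 - (1 - s) ^+ size y).

(** The broken stick lies on the segment from [stick_law s y] to the uniform law, at parameter
    $m=(1-s)^{|y|}$. A single direction and $d=1$ suffice. *)
Lemma stick_law_approx (F : realFieldType) (I V : finType) (k : nat)
    (A : {ffun I -> V} -> F) (s : F) (y : seq V) :
  (0 < #|V|)%N -> degle k A -> (0 < k)%N -> (forall C, 0 <= A C <= 1) ->
  0 < s <= 1 -> (0 < size y)%N -> k%:R ^+ 2 * (1 - s) ^+ size y <= 1 ->
  `|expect A (stick s y (uniform F)) - expect A (stick_law s y)|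
   <= 4 * (k%:R ^+ 2 * (1 - s) ^+ size y).
Proof.
move=> V0 hA k0 A01 /andP[s0 s1] y0; set m := (1 - s) ^+ _ => mk.
have m0 : 0 <= m by rewrite exprn_ge0 // subr_ge0.
have m1 : 0 < 1 - m by rewrite subr_gt0 exprn_ilt1 ?subr_ge0 // ?gtrBl // -lt0n.
have [u0 u1] := is_prob_uniform F V0.
have := @expect_line_bound F I V unit k 1 A (stick_law s y)
  (fun _ v => uniform F v - stick_law s y v) m hA k0 A01.
rewrite card_unit mul1r mulr1 big_const card_unit /= addr0 expr1.
have -> : expect A (fun v => stick_law s y v + (uniform F v - stick_law s y v) * m)
   = expect A (stick s y (uniform F)).
  apply: eq_expect => v; rewrite [RHS]stick_split /stick_law -/m.
  by field; rewrite gt_eqF.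
apply=> //; last by left.
- split=> [v|]; first by rewrite divr_ge0 ?(ltW m1) // stick0_ge0 // (ltW s0).
  by rewrite -mulr_suml sum_stick0 divff // gt_eqF.
- by move=> _; split=> [v|]; [rewrite addrC subrK | under eq_bigr do rewrite addrC subrK].
Qed.

(** A map [C] with some value outside [y] has weight zero, so only the entries of [X] at the atoms
    matter. This is what makes the mean computable from the queries to [y]. *)
Lemma expect_stick_law_eq (F : realFieldType) (I V M : finType)
    (B : {ffun I -> M} -> F) (s : F) (y : seq V) (X X' : {ffun V -> M}) :
  {in y, X =1 X'} ->
  expect (fun C : {ffun I -> V} => B [ffun i => X (C i)]) (stick_law s y) =
  expect (fun C : {ffun I -> V} => B [ffun i => X' (C i)]) (stick_law s y).
Proof.
move=> XX'; apply: eq_bigr => C _.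
have [h|/forallPn [i hi]] := boolP [forall i, C i \in y].
  congr (B _ * _); apply/ffunP => i; rewrite !ffunE XX' //.
  by move/forallP: h => /(_ i).
rewrite (bigD1 i) //= /stick_law (stick0_notin _ hi).
by rewrite mul0r mul0r !mulr0.
Qed.

(** A rational substitute for exponential decay: the leftover mass is at most $1/(1+Js)$. *)
Lemma expr_1subr_le (F : realFieldType) (s : F) (J : nat) :
  0 <= s <= 1 -> (1 - s) ^+ J * (1 + J%:R * s) <= 1.
Proof.
case/andP=> s0 s1; elim: J => [|J IHJ]; first by rewrite expr0 mul1r mul0r addr0.
apply: le_trans IHJ; rewrite exprSr -mulrA ler_wpM2l ?exprn_ge0 ?subr_ge0 //.
rewrite -natr1; have : 0 <= J%:R :> F by rewrite ler0n.
move: (J%:R : F) => j j0; rewrite -subr_ge0.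
have -> : 1 + j * s - (1 - s) * (1 + (j + 1) * s) = (j + 1) * s ^+ 2 by ring.
by rewrite mulr_ge0 ?sqr_ge0 // addr_ge0.
Qed.

Lemma ler_avg (F : realFieldType) (V : finType) (J : nat) (f g : seq V -> F) :
  (forall y, size y = J -> f y <= g y) -> avg J f <= avg J g.
Proof.
move=> fg; rewrite /avg ler_wpM2r ?invr_ge0 ?exprn_ge0 //.
by rewrite big_seq [leRHS]big_seq; apply: ler_sum => y /size_words /fg.
Qed.

Lemma avg_affine (F : realFieldType) (V : finType) (J : nat) (a b : F) (f : seq V -> F) :
  (0 < #|V|)%N -> avg J (fun y => a + b * f y) = a + b * avg J f.
Proof.
move=> V0; rewrite /avg big_split /= -mulr_sumr mulrDl -mulrA; congr (_ + _).
rewrite (eq_bigr (fun=> a * 1)) => [|y _]; last by rewrite mulr1.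
by rewrite -mulr_sumr -mulrA -[X in _ * X]/(avg J (fun=> 1)) avg1 // mulr1.
Qed.

(** Triangle inequality through the broken stick with uniform remainder: the first term is the cost
    of breaking off $J$ atoms, the second that of discarding the remainder. *)
Lemma stick_law_uniform (F : realFieldType) (I V : finType) (k J : nat)
    (A : {ffun I -> V} -> F) (s : F) :
  (0 < #|V|)%N -> degle k A -> (0 < k)%N -> (forall C, 0 <= A C <= 1) ->
  0 < s -> k%:R ^+ 2 * s <= 1 -> (0 < J)%N -> k%:R ^+ 2 * (1 - s) ^+ J <= 1 ->
  `|avg J (fun y => expect A (stick_law s y)) - expect A (uniform F)| <=
    J%:R * (4 * (k%:R ^+ 2 * s) ^+ 2) + 4 * (k%:R ^+ 2 * (1 - s) ^+ J).
Proof.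
move=> V0 hA k0 A01 s0 sk J0 mk.
have s1 : s <= 1.
  apply: le_trans sk; rewrite -[leLHS]mul1r ler_wpM2r ?(ltW s0) // -natrX ler1n expn_gt0.
  by rewrite k0.
have := @stick_approx F I V k J A s 1 (fun=> 0) V0 hA k0 A01 (ltW s0) sk.
rewrite sumr_const mul0rn add0r => /(_ (fun=> lexx _) ler01 erefl).
rewrite (@eq_expect _ _ _ A _ (uniform F)); last by move=> v; rewrite mul1r add0r.
set B := avg J _; set e := J%:R * _; set d := 4 * _ => h.
have hB : B = avg J (fun y => expect A (stick s y (uniform F))).
  by congr (_ / _); apply: eq_bigr => y _; apply: eq_expect => v; rewrite mul1r add0r.
have d1 y : size y = J -> `|expect A (stick s y (uniform F)) - expect A (stick_law s y)| <= d.
  move=> yJ; rewrite /d -yJ; apply: stick_law_approx => //; rewrite ?yJ //.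
  by rewrite s0.
have l1 : avg J (fun y => expect A (stick_law s y)) <= d + 1 * B.
  rewrite hB -avg_affine //; apply: ler_avg => y /d1; rewrite ler_norml => /andP[? ?]; lra.
have l2 : (- d) + 1 * B <= avg J (fun y => expect A (stick_law s y)).
  rewrite hB -avg_affine //; apply: ler_avg => y /d1; rewrite ler_norml => /andP[? ?]; lra.
by move: h; rewrite !ler_norml => /andP[? ?]; apply/andP; split; lra.
Qed.

Lemma is_prob_stick_law (F : realFieldType) (V : finType) (s : F) (y : seq V) :
  0 < s <= 1 -> (0 < size y)%N -> is_prob (stick_law s y).
Proof.
case/andP=> s0 s1 y0.
have m1 : 0 < 1 - (1 - s) ^+ size y.
  by rewrite subr_gt0 exprn_ilt1 ?subr_ge0 // ?gtrBl // -lt0n.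
split=> [v|]; first by rewrite divr_ge0 ?(ltW m1) // stick0_ge0 // (ltW s0).
by rewrite -mulr_suml sum_stick0 divff // gt_eqF.
Qed.

(* J and s are chosen so that J * s = 192 * k^2, which makes both terms of the
   preceding bound at most 1/48. *)
Lemma stick_law_uniform_24 (F : realFieldType) (I V : finType) (k J : nat)
    (A : {ffun I -> V} -> F) (s : F) :
  (0 < #|V|)%N -> degle k A -> (0 < k)%N -> (forall C, 0 <= A C <= 1) ->
  J = (192 ^ 3 * k ^ 8)%N -> s = ((192 ^ 2 * k ^ 6)%N%:R)^-1 ->
  `|avg J (fun y => expect A (stick_law s y)) - expect A (uniform F)|
     <= 1 / 24.
Proof.
move=> V0 hA k0 A01 hJ hs.
have kF : 0 < k%:R :> F by rewrite ltr0n.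
have k1 : 1 <= k%:R :> F by rewrite ler1n.
have sE : s = (192 ^+ 2 * k%:R ^+ 6)^-1 by rewrite hs natrM !natrX.
have JE : J%:R = 192 ^+ 3 * k%:R ^+ 8 :> F by rewrite hJ natrM !natrX.
have Js : J%:R * s = 192 * k%:R ^+ 2.
  by rewrite JE sE; field; rewrite gt_eqF.
have s0 : 0 < s by rewrite sE invr_gt0 mulr_gt0 ?exprn_gt0 // ltr0n.
have J0 : (0 < J)%N by rewrite hJ muln_gt0 !expn_gt0 k0.
have ks : k%:R ^+ 2 * s <= 1.
  rewrite sE ler_pdivrMr ?mul1r ?mulr_gt0 ?exprn_gt0 ?ltr0n //.
  apply: (@le_trans _ _ (k%:R ^+ 6)); first by rewrite ler_weXn2l.
  by rewrite ler_peMl ?exprn_ge0 ?(ltW kF) // exprn_ege1 // ler1n.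
have s1 : s <= 1.
  apply: le_trans ks; rewrite ler_peMl ?(ltW s0) // exprn_ege1 //.
(* Since $Js=192k^2$, the leftover mass is at most $1/(1+192k^2)$. *)
have mk : k%:R ^+ 2 * (1 - s) ^+ J <= 1 / 192.
  have := @expr_1subr_le F s J; rewrite (ltW s0) s1 Js => /(_ isT).
  set m := (1 - s) ^+ J => h; have m0 : 0 <= m by rewrite exprn_ge0 // subr_ge0.
  by move: h; rewrite mulrDr mulr1 mulrCA [k%:R ^+ 2 * m]mulrC; lra.
apply: le_trans (stick_law_uniform V0 hA k0 A01 s0 ks J0 _) _.
  by apply: le_trans mk _; lra.
have -> : J%:R * (4 * (k%:R ^+ 2 * s) ^+ 2) = 1 / 48.
  by rewrite JE sE; field; rewrite gt_eqF.
move: (k%:R ^+ 2 * _) mk => z mk; clear -mk; lra.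
Qed.

(** * The Polya urn *)

(* Unnormalised Polya urn weight of a partial assignment: w = -1 is sampling
   without replacement, w = 0 is independent sampling. *)
Definition polya (K : comNzRingType) (I V : finType) (w : K) (l : seq (I * V)) : K :=
  \prod_v \prod_(0 <= j < count (fun p => p.2 == v) l) (1 + j%:R * w).

Definition graph (I V : finType) (C : {ffun I -> V}) : seq (I * V) :=
  [seq (i, C i) | i <- enum I].

Lemma polya_cons (K : comNzRingType) (I V : finType) (w : K) (p : I * V) l :
  polya w (p :: l) = polya w l * (1 + (count (fun q => q.2 == p.2) l)%:R * w).
Proof.
rewrite /polya (bigD1 p.2) //= eqxx add1n big_nat_recr //=.
rewrite [in RHS](bigD1 p.2) //= mulrAC; congr (_ * _ * _); apply: eq_bigr => v.
by rewrite eq_sym => /negPf ->.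
Qed.

Lemma polya_perm (K : comNzRingType) (I V : finType) (w : K) (l l' : seq (I * V)) :
  perm_eq l l' -> polya w l = polya w l'.
Proof. by move=> /seq.permP h; apply: eq_bigr => v _; rewrite h. Qed.

Lemma sum_count_snd (I V : finType) (l : seq (I * V)) :
  (\sum_v count (fun p => p.2 == v) l = size l)%N.
Proof.
elim: l => [|p l IHl] /=; first by rewrite big1.
rewrite big_split /= IHl (bigD1 p.2) //= eqxx big1 // => v.
by rewrite eq_sym => /negPf ->.
Qed.

Lemma uniq_fst_inj (I V : eqType) (l : seq (I * V)) p q :
  uniq (map fst l) -> p \in l -> q \in l -> p.1 = q.1 -> p = q.
Proof.
elim: l => //= r l IHl /andP[rl ul].
rewrite !inE => /predU1P[->|pl] /predU1P[->|ql] // e.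
- by rewrite e map_f in rl.
- by rewrite -e map_f in rl.
- exact: IHl.
Qed.

Lemma sum_polya_full (K : comNzRingType) (I V : finType) (w : K) (l : seq (I * V)) :
  uniq (map fst l) -> (forall i, i \in map fst l) ->
  \sum_(C : {ffun I -> V}) (mon l C)%:R * polya w (graph C) = polya w l.
Proof.
move=> ul hl.
have /fin_all_exists [c hc] : forall i, exists v, (i, v) \in l.
  by move=> i; have /mapP[[j v] jl /= ->] := hl i; exists v.
have cE p : p \in l -> c p.1 = p.2.
  by move=> pl; rewrite (uniq_fst_inj ul pl (hc p.1)).
rewrite (bigD1 (finfun c)) //= big1 ?addr0; last first.
  move=> C /eqP Cc; suff /negPf -> : ~~ mon l C by rewrite mul0r.
  apply/allP => h; apply: Cc; apply/ffunP => i; rewrite ffunE.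
  by apply/eqP; have /= := h _ (hc i).
have -> : mon l (finfun c) by apply/allP => p pl; rewrite ffunE cE.
rewrite mul1r; apply: polya_perm; apply: uniq_perm.
- by rewrite map_inj_uniq ?enum_uniq // => i j [].
- exact: map_uniq ul.
- move=> [i v]; apply/mapP/idP => [[j _ [-> ->]]|pl]; first by rewrite ffunE hc.
  by exists i; rewrite ?mem_enum // ffunE (cE _ pl).
Qed.

(** Consistency of the urn: giving all possible values to one more coordinate multiplies the weight
    by $\sum_v(1+c_vw)=|V|+|l|w$, where $c_v$ counts the earlier occurrences of $v$. The induction
    is on the number of unassigned coordinates. *)
Lemma sum_polya (K : comNzRingType) (I V : finType) (w : K) (l : seq (I * V)) :
  uniq (map fst l) ->
  \sum_(C : {ffun I -> V}) (mon l C)%:R * polya w (graph C) =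
  polya w l * \prod_(size l <= j < #|I|) (#|V|%:R + j%:R * w).
Proof.
move: {2}(#|I| - size l)%N (leqnn (#|I| - size l)%N) => d.
elim: d l => [|d IHd] l hd ul.
  rewrite big_geq ?mulr1; last by rewrite -subn_eq0 -leqn0.
  apply: sum_polya_full => // i; apply: contraTT hd => il.
  have := card_uniqP (s := i :: map fst l); rewrite /= il ul => /(_ isT) e.
  rewrite -ltnNge subn_gt0.
  by have := max_card (mem (i :: map fst l)); rewrite e size_map.
have [/forallP hl|/forallPn [i il]] := boolP [forall i, i \in map fst l].
  rewrite big_geq ?mulr1; first exact: sum_polya_full.
  rewrite -(size_map fst) -(card_uniqP ul).
  by rewrite (_ : #|I| = #|map fst l|) //; apply: eq_card => i; rewrite hl.
have sl : (size l < #|I|)%N.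
  have := card_uniqP (s := i :: map fst l); rewrite /= il ul => /(_ isT) e.
  by have := max_card (mem (i :: map fst l)); rewrite e size_map.
transitivity (\sum_v \sum_(C : {ffun I -> V}) (mon ((i, v) :: l) C)%:R * polya w (graph C)).
  rewrite exchange_big; apply: eq_bigr => C _ /=.
  rewrite -mulr_suml; congr (_ * _).
  rewrite (bigD1 (C i)) //= eqxx big1 ?addr0 // => v.
  by rewrite eq_sym => /negPf ->.
rewrite (eq_bigr (fun v => polya w ((i, v) :: l) *
    \prod_((size l).+1 <= j < #|I|) (#|V|%:R + j%:R * w))); last first.
  move=> v _; apply: (IHd ((i, v) :: l)); first by move: hd sl => /=; lia.
  by rewrite /= il.
rewrite [in RHS]big_ltn // mulrA -mulr_suml; congr (_ * _).
under eq_bigr do rewrite polya_cons.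
rewrite -mulr_sumr big_split /= -mulr_suml sumr_const -natr_sum sum_count_snd.
by [].
Qed.

(** Prepares monomials for [sum_polya], which requires distinct positions: conflicting constraints
    make the monomial vanish and repeated ones are dropped. *)
Lemma mon_uniq (I V : finType) (l : seq (I * V)) :
  (forall C : {ffun I -> V}, mon l C = false) \/
  exists l', [/\ uniq (map fst l'), (size l' <= size l)%N &
     forall C : {ffun I -> V}, mon l C = mon l' C].
Proof.
elim: l => [|p l [IHl|[l' [ul sl IHl]]]]; first by right; exists [::].
  by left=> C; rewrite /= IHl andbF.
have [/mapP[q ql e]|pl] := boolP (p.1 \in map fst l'); last first.
  by right; exists (p :: l'); split; rewrite /= ?pl // => C; rewrite IHl.
have [epq|npq] := eqVneq p.2 q.2.
  right; exists l'; split=> //; first exact: leqW.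
  move=> C; rewrite /= IHl; apply/andb_idl => /allP /(_ q ql).
  by rewrite e epq.
left=> C; rewrite /= IHl; apply/negP => /andP[/eqP h /allP /(_ q ql)].
by rewrite -e h (negPf npq).
Qed.

Lemma size_polya (F : realFieldType) (I V : finType) (l : seq (I * V)) :
  (size (polya ('X : {poly F}) l) <= (size l).+1)%N.
Proof.
elim: l => [|p l IHl] /=.
  by rewrite /polya big1 ?size_poly1 // => v _; rewrite big_geq.
rewrite polya_cons (leq_trans (size_polyMleq _ _)) //.
set c := 1 + _; have : (size c <= 2)%N.
  rewrite (leq_trans (size_polyD _ _)) // geq_max size_poly1 /=.
  by rewrite mulr_natl -scaler_nat (leq_trans (size_scale_leq _ _)) ?size_polyX.
by move=> hc; rewrite -subn1 leq_subLR (leq_trans (leq_add IHl hc)) // addn2 add1n.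
Qed.

Lemma horner_polya (F : realFieldType) (I V : finType) (l : seq (I * V)) (x : F) :
  (polya ('X : {poly F}) l).[x] = polya x l.
Proof.
rewrite horner_prod; apply: eq_bigr => v _; rewrite horner_prod; apply: eq_bigr => j _.
by rewrite hornerD hornerC mulr_natl hornerMn hornerX mulr_natl.
Qed.

(** A monomial on $m\le k$ positions yields its own weight, of degree at most $m$, times the
    normalising factors from $m$ on. Those from $k$ on are common to all monomials; the $k-m$ others
    go into [r], which keeps degree at most $k$. *)
Lemma polya_expect_poly (F : realFieldType) (I V : finType) (k : nat)
    (A : {ffun I -> V} -> F) : degle k A -> (k <= #|I|)%N ->
  exists2 r : {poly F}, (size r <= k.+1)%N & forall x,
    \sum_C A C * polya x (graph C) =
    r.[x] * \prod_(k <= j < #|I|) (#|V|%:R + j%:R * x).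
Proof.
move=> [s [hs sE]] kI.
suff [r hr rE] : exists2 r : {poly F}, (size r <= k.+1)%N & forall x,
    \sum_C (\sum_(t <- s) t.1 * (mon t.2 C)%:R) * polya x (graph C) =
    r.[x] * \prod_(k <= j < #|I|) (#|V|%:R + j%:R * x).
  by exists r => // x; rewrite -rE; apply: eq_bigr => C _; rewrite sE.
elim: s hs {A sE} => [_|[c l] s IHs /= /andP[lk /IHs [r hr rE]]].
  exists 0 => [|x]; first by rewrite size_poly0.
  by rewrite horner0 mul0r big1 // => C _; rewrite big_nil mul0r.
have [r' hr' rE'] : exists2 r : {poly F}, (size r <= k.+1)%N & forall x,
    \sum_(C : {ffun I -> V}) (mon l C)%:R * polya x (graph C) =
    r.[x] * \prod_(k <= j < #|I|) (#|V|%:R + j%:R * x).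
  case: (mon_uniq l) => [l0|[l' [ul' sl' l'E]]].
    exists 0 => [|x]; first by rewrite size_poly0.
    by rewrite horner0 mul0r big1 // => C _; rewrite l0 mul0r.
  have l'k : (size l' <= k)%N := leq_trans sl' lk.
  exists (polya ('X : {poly F}) l' *
     \prod_(size l' <= j < k) (#|V|%:R + j%:R * 'X)).
    set P := \prod_(_ <= _ < _) _.
    have sP : (size P <= (k - size l').+1)%N.
      rewrite /P -[in X in (_ <= X)%N](size_iota (size l') (k - size l')).
      rewrite /index_iota; elim: (iota _ _) => [|j r0 IHr].
        by rewrite big_nil size_poly1.
      rewrite big_cons (leq_trans (size_polyMleq _ _)) //.
      set d := _ + _; have : (size d <= 2)%N.
        rewrite (leq_trans (size_polyD _ _)) // geq_max.
        rewrite -polyC_natr (leq_trans (size_polyC_leq1 _)) //=.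
        by rewrite mulr_natl -scaler_nat (leq_trans (size_scale_leq _ _)) ?size_polyX.
      by move=> hd; rewrite -subn1 leq_subLR (leq_trans (leq_add hd IHr)).
    rewrite (leq_trans (size_polyMleq _ _)) //.
    rewrite -subn1 leq_subLR (leq_trans (leq_add (size_polya F l') sP)) //.
    by rewrite addSn addnS subnKC.
  move=> x; rewrite (eq_bigr (fun C => (mon l' C)%:R * polya x (graph C))); last first.
    by move=> C _; rewrite l'E.
  rewrite sum_polya // hornerM horner_polya -mulrA; congr (_ * _).
  rewrite (big_cat_nat l'k kI) /= horner_prod; congr (_ * _).
  apply: eq_bigr => j _.
  by rewrite -!polyC_natr !hornerE.
exists (c *: r' + r) => [|x].
  rewrite (leq_trans (size_polyD _ _)) // geq_max hr andbT.
  by rewrite (leq_trans (size_scale_leq _ _)).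
rewrite hornerD hornerZ mulrDl -rE -mulrA -rE' mulr_sumr -big_split.
by apply: eq_bigr => C _; rewrite big_cons /= mulrDl mulrA.
Qed.

Lemma polya_ge0 (F : realFieldType) (I V : finType) (w : F) (l : seq (I * V)) :
  0 <= w -> 0 <= polya w l.
Proof.
by move=> w0; apply: prodr_ge0 => v _; apply: prodr_ge0 => j _; rewrite addr_ge0 ?mulr_ge0.
Qed.

Lemma polya0 (F : realFieldType) (I V : finType) (l : seq (I * V)) : polya (0 : F) l = 1.
Proof. by apply: big1 => v _; apply: big1 => j _; rewrite mulr0 addr0. Qed.

Lemma count_graph (I V : finType) (C : {ffun I -> V}) (i j : I) :
  i != j -> C i = C j -> (1 < count (fun p => p.2 == C i) (graph C))%N.
Proof.
move=> ij Cij; rewrite count_map -size_filter.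
have sub : {subset [:: i; j] <= [seq x <- enum I | C x == C i]}.
  by move=> x; rewrite !inE mem_filter mem_enum andbT => /pred2P[] ->; rewrite ?Cij.
by apply: (uniq_leq_size _ sub); rewrite /= inE ij.
Qed.

(** At $w=-1$ a value taken twice contributes the factor $1+1\cdot(-1)=0$, and otherwise all factors
    are 1: the weight is the indicator of injectivity. *)
Lemma polyaN1_ge0 (F : realFieldType) (I V : finType) (C : {ffun I -> V}) :
  0 <= polya (-1 : F) (graph C).
Proof.
apply: prodr_ge0 => v _.
case: (count _ _) => [|[|m]]; first by rewrite big_geq.
  by rewrite big_nat1 mul0r addr0.
rewrite big_ltn // big_ltn // [X in _ * (X * _)](_ : _ = 0) ?mul0r ?mulr0 //.
by rewrite mul1r subrr.
Qed.

Lemma polyaN1_eq0 (F : realFieldType) (I V : finType) (C : {ffun I -> V}) :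
  ~ injective C -> polya (-1 : F) (graph C) = 0.
Proof.
move/injectiveP/injectivePn => [i [j ij Cij]].
rewrite /polya (bigD1 (C i)) //=; have := count_graph ij Cij.
case: (count _ _) => [|[|m]] // _.
rewrite big_ltn // big_ltn // [X in _ * (X * _) * _](_ : _ = 0) ?mul0r ?mulr0 ?mul0r //.
by rewrite mul1r subrr.
Qed.

Lemma expr_1addr_le (F : realFieldType) (a : F) (k : nat) :
  0 <= a -> (1 + a) ^+ k * (1 - k%:R * a) <= 1.
Proof.
move=> a0; elim: k => [|k IHk]; first by rewrite expr0 mul1r mul0r subr0.
apply: le_trans IHk; rewrite exprSr -mulrA ler_wpM2l ?exprn_ge0 ?addr_ge0 //.
rewrite -natr1 -subr_ge0; have : 0 <= k%:R :> F by rewrite ler0n.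
move: (k%:R : F) => j j0.
have -> : 1 - j * a - (1 + a) * (1 - (j + 1) * a) = (j + 1) * a ^+ 2 by ring.
by rewrite mulr_ge0 ?sqr_ge0 // addr_ge0.
Qed.

Lemma expr_1subr_ge (F : realFieldType) (a : F) (k : nat) :
  0 <= a <= 1 -> 1 - k%:R * a <= (1 - a) ^+ k.
Proof.
case/andP=> a0 a1; elim: k => [|k IHk]; first by rewrite expr0 mul0r subr0.
have h : 0 <= 1 - a by rewrite subr_ge0.
rewrite exprSr; apply: le_trans (ler_wpM2r h IHk).
rewrite -natr1 -subr_ge0; have : 0 <= k%:R :> F by rewrite ler0n.
move: (k%:R : F) => j j0.
have -> : (1 - j * a) * (1 - a) - (1 - (j + 1) * a) = j * a ^+ 2 by ring.
by rewrite mulr_ge0 ?sqr_ge0.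
Qed.

Lemma prod_const_nat (F : comNzRingType) (k : nat) (c : F) :
  \prod_(0 <= j < k) c = c ^+ k.
Proof. by rewrite prodr_const_nat subn0. Qed.

(** With $w=hx-1$, injective maps sit at $x=0$ and uniform maps at $x=1/h$, while every node
    $x=j^2\ge1$ has $w\ge0$, where urn weights are nonnegative. Interpolation with bound 2 costs
    $8/h$ between $0$ and $1/h$; the normalisation at $w=-1$ costs another $1/h$. *)
Lemma uniform_vs_injective (F : realFieldType) (I V : finType) (k h : nat)
    (A : {ffun I -> V} -> F) (al be : F) :
  degle k A -> (0 < k)%N -> (0 < h)%N -> #|I| = #|V| -> (2 * h * k ^ 4 <= #|V|)%N ->
  (forall C, 0 <= A C <= 1) -> 0 <= al -> 0 <= be ->
  (forall C : {ffun I -> V}, injective C -> al <= A C <= be) -> al <= 1 ->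
  al - 9 / h%:R <= expect A (uniform F) <= be + 9 / h%:R.
Proof.
move=> hA k0 h0 IV hn A01 al0 be0 Aab al1.
set n := #|V| in IV hn *.
have k4 : (k <= k ^ 4)%N by rewrite -[X in (X <= _)%N]expn1 leq_pexp2l.
have kn : (k <= n)%N.
  by apply: leq_trans k4 _; apply: leq_trans hn; rewrite leq_pmull // muln_gt0.
have n0 : (0 < n)%N := leq_trans k0 kn.
have kI : (k <= #|I|)%N by rewrite IV.
have [r hr] := polya_expect_poly hA kI; rewrite IV -/n => rE.
have nF : 0 < n%:R :> F by rewrite ltr0n.
have hF : 0 < h%:R :> F by rewrite ltr0n.
have kF : 0 < k%:R :> F by rewrite ltr0n.
(* The total urn weight is [G x * D x], so [r / G] is the normalised mean; replacing [G] by the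
   constant $n^k$ keeps a polynomial. *)
pose G (x : F) := \prod_(0 <= j < k) (n%:R + j%:R * x).
pose D (x : F) := \prod_(k <= j < n) (n%:R + j%:R * x).
have {}rE x : \sum_C A C * polya x (graph C) = r.[x] * D x by exact: rE.
have GD x : \sum_(C : {ffun I -> V}) polya x (graph C) = G x * D x.
  have := @sum_polya F I V x [::] isT; rewrite /=.
  rewrite (_ : polya x [::] = 1); last by apply: big1 => v _; rewrite big_geq.
  rewrite mul1r IV -/n (big_cat_nat (leq0n k) kn) /= => <-.
  by apply: eq_bigr => C _; rewrite mul1r.
have D_gt0 x : -1 <= x -> 0 < D x.
  move=> x1; rewrite /D big_nat_cond; apply: prodr_gt0 => j; rewrite andbT => /andP[_ jn].
  have : j%:R * -1 <= j%:R * x by rewrite ler_wpM2l.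
  have : j%:R < n%:R :> F by rewrite ltr_nat.
  lra.
have r_bounds x : 0 <= x -> 0 <= r.[x] <= G x.
  move=> x0; have D0 : 0 < D x by apply: D_gt0; lra.
  apply/andP; split; first (rewrite -(pmulr_lge0 _ D0) -rE).
    by apply: sumr_ge0 => C _; rewrite mulr_ge0 ?polya_ge0 //; case/andP: (A01 C).
  rewrite -(ler_pM2r D0) -rE -GD.
  apply: ler_sum => C _; rewrite ler_piMl ?polya_ge0 //; by case/andP: (A01 C).
have rN1 a b : (forall C : {ffun I -> V}, injective C -> a <= A C <= b) ->
    a * G (-1) <= r.[-1] <= b * G (-1).
  move=> Cab; have D0 := D_gt0 (-1) (lexx _).
  apply/andP; split; rewrite -(ler_pM2r D0) -rE -mulrA -GD mulr_sumr;
  apply: ler_sum => C _;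
  (have [/Cab/andP[? ?]|nC] := pselect (injective C);
   [by rewrite ler_wpM2r ?polyaN1_ge0 | by rewrite polyaN1_eq0 // !mulr0]).
have r0 : r.[0] = n%:R ^+ k * expect A (uniform F).
  have D0 : D 0 = n%:R ^+ (n - k).
    by rewrite /D; under eq_bigr do rewrite mulr0 addr0; rewrite prodr_const_nat.
  apply: (@mulIf _ (D 0)); first by rewrite gt_eqF // D_gt0 // lerN10.
  rewrite -rE D0 mulrAC -exprD subnKC // /expect mulr_sumr; apply: eq_bigr => C _.
  rewrite polya0 mulr1 prodr_const IV -/n exprVn mulrCA divff ?mulr1 //.
  by rewrite expf_neq0 // gt_eqF.
pose q := n%:R ^- k *: (r \Po (h%:R *: 'X - 1%:P)).
have qE x : q.[x] = n%:R ^- k * r.[h%:R * x - 1].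
  by rewrite hornerZ horner_comp !hornerE.
have nk0 : 0 < n%:R ^- k :> F by rewrite invr_gt0 exprn_gt0.
have GnE x : n%:R ^- k * G x = \prod_(0 <= j < k) (1 + j%:R * x / n%:R).
  rewrite -exprVn -(prod_const_nat k) -big_split; apply: eq_bigr => j _ /=.
  by field; rewrite gt_eqF.
have hkn : 2 * h%:R * k%:R ^+ 4 <= n%:R :> F by rewrite -natrX -!natrM ler_nat.
(* Each factor is at most $1+a$ with $a=hk^3/n$, and $ka\le1/2$ by the size assumption on $n$,
   whence $(1+a)^k\le1/(1-ka)\le2$. *)
have Gn_le x : 0 <= x -> x <= h%:R * k%:R ^+ 2 -> n%:R ^- k * G x <= 2.
  move=> x0 xk; rewrite GnE; set a := k%:R * (h%:R * k%:R ^+ 2) / n%:R : F.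
  have a0 : 0 <= a by rewrite !mulr_ge0 ?invr_ge0 ?exprn_ge0 // ltW.
  have ka : 1 / 2 <= 1 - k%:R * a.
    suff : k%:R * a <= 1 / 2 by lra.
    rewrite /a [leLHS]mulrA ler_pdivrMr //; lra.
  apply: (@le_trans _ _ ((1 + a) ^+ k)).
    rewrite -prod_const_nat !big_nat; apply: ler_prod => j /andP[_ jk].
    have jx : 0 <= j%:R * x / n%:R by rewrite !mulr_ge0 ?invr_ge0 // ltW.
    rewrite addr_ge0 //= lerD2l ler_wpM2r ?invr_ge0 ?(ltW nF) //.
    by rewrite ler_pM // ler_nat ltnW.
  have := expr_1addr_le k a0; have p0 : 0 <= (1 + a) ^+ k by rewrite exprn_ge0 // addr_ge0.
  have := ler_wpM2l p0 ka; lra.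
(* Here $g=\prod_{j<k}(1-j/n)\ge1-k^2/n\ge1-1/h$. *)
set g := n%:R ^- k * G (-1); have g01 : 1 - h%:R^-1 <= g <= 1.
  rewrite /g GnE; apply/andP; split; last first.
    rewrite big_nat; apply: prodr_ile1 => j /andP[_ jk].
    rewrite mulrN1 mulNr subr_ge0 ler_pdivrMr // mul1r ler_nat.
    by rewrite (leq_trans (ltnW jk)) //= gerDl oppr_le0 divr_ge0 // ler0n.
  have b01 : 0 <= (k%:R / n%:R : F) <= 1.
    by rewrite divr_ge0 ?ler0n //= ler_pdivrMr // mul1r ler_nat.
  apply: (@le_trans _ _ ((1 - k%:R / n%:R) ^+ k)).
    apply: le_trans (expr_1subr_ge k b01); rewrite lerD2l lerN2 mulrA ler_pdivrMr //.
    rewrite [leRHS]mulrC ler_pdivlMr // -!natrM ler_nat; apply: leq_trans hn.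
    by rewrite mulnC mulnn leq_mul ?leq_pmull ?leq_pexp2l.
  rewrite -prod_const_nat !big_nat; apply: ler_prod => j /andP[_ jk].
  case/andP: b01 => b0 b1; rewrite subr_ge0 b1 /= mulrN1 mulNr lerD2l lerN2.
  by rewrite ler_wpM2r ?invr_ge0 ?ler0n // ler_nat ltnW.
have q0 : q.[0] = n%:R ^- k * r.[-1] by rewrite qE mulr0 sub0r.
have q0_bounds a b : (forall C : {ffun I -> V}, injective C -> a <= A C <= b) ->
    a * g <= q.[0] <= b * g.
  move=> /rN1 /andP[l1 l2]; rewrite q0 /g [a * _]mulrCA [b * _]mulrCA.
  by rewrite !ler_wpM2l // ltW.
have q_main : `|q.[h%:R^-1] - q.[0]| <= 4 * 2 * h%:R^-1 ^+ 1.
  apply: (@le_bounded_at_nodes _ k 1) => //.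
  - rewrite (leq_trans (size_scale_leq _ _)) // (leq_trans (size_comp_poly_leq _ _)) //.
    rewrite ltnS; set d := h%:R *: _ - _; have : (size d <= 2)%N.
      rewrite (leq_trans (size_polyD _ _)) // geq_max size_polyN.
      by rewrite (leq_trans (size_scale_leq _ _)) ?size_polyX // (leq_trans (size_polyC_leq1 _)).
    move=> sd; rewrite -[X in (_ <= X)%N]muln1 leq_mul //; rewrite -subn1 leq_subLR ?add1n //.
  - by case.
  (* Node 0 is $w=-1$, outside the range of [r_bounds]; there only injective maps have weight and
     [q0_bounds] is used instead. *)
  - case=> [_|j jk].
      have /andP[l1 l2] := q0_bounds 0 1 (fun C _ => A01 C).
      rewrite (_ : node F 0 = 0) //; move: l1 l2; rewrite mul0r mul1r => -> l2 /=.
      by apply: le_trans l2 _; case/andP: g01 => _ g1; apply: le_trans g1 _; rewrite ler1n.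
    rewrite qE; set x := _ - 1.
    have x0 : 0 <= x by rewrite subr_ge0 /node -natrM ler1n muln_gt0 h0 expn_gt0.
    have xk : x <= h%:R * k%:R ^+ 2.
      rewrite lerBlDr; apply: (@le_trans _ _ (h%:R * k%:R ^+ 2)); last by rewrite lerDl.
      by rewrite ler_wpM2l // /node -natrX ler_nat leq_exp2r.
    have /andP[l1 l2] := r_bounds x x0.
    rewrite mulr_ge0 ?(ltW nk0) //=; apply: le_trans (Gn_le x x0 xk).
    by rewrite ler_wpM2l // ltW.
  - by rewrite invr_ge0 ler0n /= invf_le1 // ler1n.
have qh : q.[h%:R^-1] = expect A (uniform F).
  rewrite qE divff ?gt_eqF // subrr r0 mulKf //.
  by rewrite expf_neq0 // gt_eqF.
move: q_main; rewrite qh expr1 ler_norml => /andP[m1 m2].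
have /andP[l1 l2] := q0_bounds al be Aab; case/andP: g01 => g0 g1.
have hV : 0 < h%:R^-1 :> F by rewrite invr_gt0.
have : be * g <= be by rewrite ler_piMr.
have : al * (1 - h%:R^-1) <= al * g by rewrite ler_wpM2l.
have : al * h%:R^-1 <= h%:R^-1 by rewrite ler_piMl // ltW.
move: (h%:R^-1 : F) hV m1 m2 l1 l2 => e e0 m1 m2 l1 l2 e1 e2 e3.
by apply/andP; split; lra.
Qed.

(** * Quantum algorithms *)

(** Common form of the oracle and of the storing step in the exact algorithm below. *)
Definition perm_op (N M d : nat) (phi : qbasis N M d -> qbasis N M d) : 'M[C]_(qdim N M d) :=
  \matrix_(r, c) (enum_val r == phi (enum_val c))%:R.

Lemma perm_op_unitary (N M d : nat) (phi : qbasis N M d -> qbasis N M d) :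
  injective phi -> perm_op phi \is unitarymx.
Proof.
move=> phiI; apply/unitarymxP/matrixP => i j; rewrite !mxE.
have [psi phiK psiK] := injF_bij phiI.
rewrite (bigD1 (enum_rank (psi (enum_val i)))) //= big1 ?addr0.
  rewrite !mxE enum_rankK psiK eqxx mul1r conjC_nat.
  by rewrite (inj_eq enum_val_inj) eq_sym.
move=> c ci; rewrite !mxE; case: eqP => [e|_]; last by rewrite mul0r.
by move: ci; rewrite e phiK enum_valK eqxx.
Qed.

Lemma perm_op_basis (N M d : nat) (phi : qbasis N M d -> qbasis N M d) s :
  perm_op phi *m basis_vec s = basis_vec (phi s).
Proof.
apply/matrixP => r j; rewrite !mxE (bigD1 (enum_rank s)) //= big1 ?addr0.
  by rewrite !mxE enum_rankK eqxx mulr1.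
move=> c cs; rewrite !mxE; case: (enum_val c =P s) => [e|_]; last by rewrite mulr0.
by move: cs; rewrite -e enum_valK eqxx.
Qed.

Lemma addM_inj (M : nat) (x : 'I_M) : injective (fun z : 'I_M => addM z x).
Proof.
move=> z z' /(congr1 val) /= /eqP; rewrite eqn_modDr !modn_small ?ltn_ord //.
by move/eqP/val_inj.
Qed.

Lemma oracle_map_inj (N M d : nat) (X : input N M) :
  injective (@oracle_map N M d X).
Proof.
move=> [[i z] w] [[j z'] w'] h.
have /= ei := congr1 (fun s => s.1.1) h; have /= ew := congr1 snd h.
by have /= := congr1 (fun s => s.1.2) h; rewrite ei ew => /addM_inj ->.
Qed.

Lemma oracleE (N M d : nat) (X : input N M) : oracle d X = perm_op (@oracle_map N M d X).
Proof. by []. Qed.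

Definition sqnorm (n : nat) (psi : 'cV[C]_n) : C := \sum_r `|psi r 0| ^+ 2.

Lemma sqnorm_unitary (n : nat) (U : 'M[C]_n) (psi : 'cV[C]_n) :
  U \is unitarymx -> sqnorm (U *m psi) = sqnorm psi.
Proof.
have sqE m (v : 'cV[C]_m) : sqnorm v = (map_mx Num.conj (trmx v) *m v) 0 0.
  by rewrite mxE; apply: eq_bigr => r _; rewrite !mxE normCK mulrC.
move=> /unitarymxP UU; rewrite !sqE trmx_mul map_mxM /= mulmxA -(mulmxA _ _ U).
by rewrite (mulmx1C UU) mulmx1.
Qed.

Lemma sqnorm_basis (N M d : nat) (s : qbasis N M d) : sqnorm (basis_vec s) = 1.
Proof.
rewrite /sqnorm (bigD1 (enum_rank s)) //= big1 ?addr0.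
  by rewrite mxE enum_rankK eqxx normr1 expr1n.
move=> r rs; rewrite mxE; case: eqP => [e|_]; last by rewrite normr0 expr0n.
by move: rs; rewrite -e enum_valK eqxx.
Qed.

Lemma sqnorm_q_state (N M T : nat) (A : qalg N M T) (X : input N M) :
  (forall k, (k <= T)%N -> qa_U A k \is unitarymx) ->
  forall k, (k <= T)%N -> sqnorm (q_state A X k) = 1.
Proof.
move=> unit_U; elim=> [|k IHk] kT /=.
  by rewrite sqnorm_unitary ?unit_U // sqnorm_basis.
rewrite sqnorm_unitary ?unit_U // oracleE sqnorm_unitary; first exact: IHk (ltnW kT).
exact/perm_op_unitary/oracle_map_inj.
Qed.

Lemma q_prob_sum (N M T : nat) (A : qalg N M T) (X : input N M) :
  (forall k, (k <= T)%N -> qa_U A k \is unitarymx) ->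
  q_prob A X true + q_prob A X false = 1.
Proof.
move=> /(@sqnorm_q_state _ _ _ _ X) /(_ T (leqnn T)) <-.
rewrite /sqnorm (reindex enum_rank); last first.
  by exists enum_val => s _; rewrite ?enum_rankK ?enum_valK.
rewrite [RHS](bigID (fun s => qa_out A s == true)) /=; congr (_ + _).
by apply: eq_bigl => s; case: qa_out.
Qed.

Lemma q_prob_ge0 (N M T : nat) (A : qalg N M T) (X : input N M) b : 0 <= q_prob A X b.
Proof. by apply: sumr_ge0 => s _; rewrite exprn_ge0. Qed.

Lemma degle_oracle (N M d : nat) (r c : 'I_(qdim N M d)) :
  degle 1 (fun X : input N M => oracle d X r c).
Proof.
case e : (enum_val c) => [[i z] w].
apply: (@eq_degle _ _ _ _ (fun X : input N M =>
   \sum_v (X i == v)%:R * (enum_val r == (i, addM z v, w))%:R)).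
  move=> X; rewrite mxE e /= (bigD1 (X i)) //= eqxx mul1r big1 ?addr0 // => v.
  by rewrite eq_sym => /negPf ->; rewrite mul0r.
apply: degle_sum => v _ _; rewrite -[X in degle X](addn0 1).
by apply: degle_mul; [apply: degle_eval | apply: degle_const].
Qed.

(** The polynomial method: every oracle call raises the degree of the amplitudes by one, and the
    unitaries between calls have constant entries. *)
Lemma degle_q_state (N M T : nat) (A : qalg N M T) (k : nat) (r : 'I_(qdim N M (qa_d A))) :
  degle k (fun X : input N M => q_state A X k r 0).
Proof.
elim: k r => [|k IHk] r; first exact: degle_const.
apply: (@eq_degle _ _ _ _ (fun X : input N M => \sum_j qa_U A k.+1 r j *
   \sum_c oracle (qa_d A) X j c * q_state A X k c 0)).
  by move=> X /=; rewrite mxE; apply: eq_bigr => j _; rewrite mxE.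
apply: degle_sum => j _ _; apply: (@degle_mul _ _ _ 0%N _ (fun=> _)).
  exact: degle_const.
apply: degle_sum => c _ _; rewrite -add1n.
by apply: degle_mul; [apply: degle_oracle | apply: IHk].
Qed.

Lemma degle_q_prob (N M T : nat) (A : qalg N M T) (b : bool) :
  degle (T + T) (fun X : input N M => complex.Re (q_prob A X b)).
Proof.
apply: (degle_map (f := @complex.Re R)) => //; first by move=> [? ?] [? ?].
apply: degle_sum => s _ _.
apply: (@eq_degle _ _ _ _ (fun X : input N M => q_state A X T (enum_rank s) 0 *
   Num.conj (q_state A X T (enum_rank s) 0))).
  by move=> X; rewrite normCK.
apply: degle_mul; first exact: degle_q_state.
apply: degle_map; [exact: rmorph0 | exact: rmorphD | exact: degle_q_state].
Qed.

(** The acceptance probability of the majority of three independent runs, $p^3+3p^2(1-p)$. *)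
Definition amplify (F : comNzRingType) (p : F) : F := p ^+ 2 * (3 - 2 * p).

Lemma degle_amplify (F : comNzRingType) (I V : finType) (k : nat)
    (A : {ffun I -> V} -> F) : degle k A -> degle (3 * k) (fun X => amplify (A X)).
Proof.
move=> hA; rewrite (_ : 3 * k = (k + k) + (0 + k))%N; last by lia.
apply: (@eq_degle _ _ _ _ (fun X => (A X * A X) * (3 + (-2) * A X))).
  by move=> X; rewrite /amplify expr2 mulNr.
apply: degle_mul; first exact: degle_mul.
apply: degle_add; first exact: degle_const.
by apply: (@degle_mul _ _ _ 0%N _ (fun=> -2)) => //; apply: degle_const.
Qed.

Lemma amplify_bounds (F : realFieldType) (p : F) : 0 <= p <= 1 -> 0 <= amplify p <= 1.
Proof.
case/andP=> p0 p1; apply/andP; split; first by rewrite mulr_ge0 ?sqr_ge0 //; lra.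
rewrite -subr_ge0 /amplify.
have -> : 1 - p ^+ 2 * (3 - 2 * p) = (1 - p) ^+ 2 * (1 + 2 * p) by ring.
by rewrite mulr_ge0 ?sqr_ge0 //; lra.
Qed.

Lemma amplify_sym (F : realFieldType) (p : F) : amplify (1 - p) = 1 - amplify p.
Proof. by rewrite /amplify; ring. Qed.

Lemma amplify_mono (F : realFieldType) (p q : F) :
  0 <= p -> p <= q -> q <= 1 -> amplify p <= amplify q.
Proof.
move=> p0 pq q1; rewrite -subr_ge0 /amplify.
have -> : q ^+ 2 * (3 - 2 * q) - p ^+ 2 * (3 - 2 * p) =
   (q - p) * (3 * q * (1 - q) + 3 * p * (1 - p) + (q - p) ^+ 2) by ring.
by rewrite mulr_ge0 ?subr_ge0 // !addr_ge0 ?sqr_ge0 // !mulr_ge0 // ?subr_ge0 //; lra.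
Qed.

(** By monotonicity it is enough to follow the lower bounds $2/3$, $0.74$, $0.83$, $0.92$. *)
Lemma amplify3_large (F : realFieldType) (p : F) : 2 / 3 <= p <= 1 ->
  92 / 100 <= amplify (amplify (amplify p)).
Proof.
have step (a b q : F) : b <= amplify a -> 0 <= a -> a <= q <= 1 -> b <= amplify q <= 1.
  move=> ba a0 /andP[aq q1]; have q0 : 0 <= q by lra.
  have /andP[_ ->] : 0 <= amplify q <= 1 by rewrite amplify_bounds // q0.
  by rewrite andbT (le_trans ba) // amplify_mono.
move=> h; have h1 : 74 / 100 <= amplify p <= 1 by apply: step _ _ h; rewrite /amplify; lra.
have h2 : 83 / 100 <= amplify (amplify p) <= 1 by apply: step _ _ h1; rewrite /amplify; lra.
by have /andP[] : 92 / 100 <= amplify (amplify (amplify p)) <= 1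
  by apply: step _ _ h2; rewrite /amplify; lra.
Qed.

(** The acceptance probability has degree $2T$ and each of three amplifications triples it, giving
    $54T$. Inputs with value [false] follow from the symmetry of [amplify] under $p\mapsto1-p$. *)
Lemma q_computes_poly (N M T : nat) (f : pfun N M) : q_computes f T ->
  exists A : input N M -> R, [/\ degle (54 * T) A, forall X, 0 <= A X <= 1 &
    forall X, (f X = Some true -> 92 / 100 <= A X) /\
              (f X = Some false -> A X <= 8 / 100)].
Proof.
move=> [Q [QU Qf]]; pose p (X : input N M) := complex.Re (q_prob Q X true).
have pre b X : 0 <= complex.Re (q_prob Q X b).
  by have := q_prob_ge0 Q X b; rewrite complex.lecE => /andP[].
have psum X : p X + complex.Re (q_prob Q X false) = 1.
  have := congr1 (@complex.Re R) (q_prob_sum X QU).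
  by rewrite /p; case: (q_prob _ _ _); case: (q_prob _ _ _).
have two_thirds b X : f X = Some b -> 2 / 3 <= complex.Re (q_prob Q X b).
  move=> /Qf; rewrite complex.lecE => /andP[_].
  suff -> : complex.Re (2 / 3 : C) = 2 / 3 by [].
  have -> : (2 / 3 : C) = complex.real_complex R (2 / 3).
    by rewrite fmorph_div !rmorph_nat.
  by [].
have p01 X : 0 <= p X <= 1.
  by have := psum X; have := pre false X; have := pre true X; rewrite /p; lra.
exists (fun X => amplify (amplify (amplify (p X)))); split.
- rewrite (_ : 54 * T = 3 * (3 * (3 * (T + T))))%N; last by lia.
  by do 3 apply: degle_amplify; apply: degle_q_prob.
- by move=> X; do 3 apply: amplify_bounds.
- move=> X; split=> [/two_thirds h|/two_thirds h].
    by apply: amplify3_large; rewrite h; case/andP: (p01 X).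
  have h' : 2 / 3 <= 1 - p X <= 1.
    by have := p01 X; have := psum X; rewrite /p in h *; lra.
  by have := amplify3_large h'; rewrite !amplify_sym; lra.
Qed.

(** * An exact quantum algorithm with N queries *)

Definition upd (N M : nat) (X : input N M) (i : 'I_N) (v : 'I_M) : input N M :=
  [ffun j => if j == i then v else X j].

(* Swaps the answer register with the i-th cell of the workspace, which stores
   the values read so far, and moves on to the next index. *)
Definition store_step (N M : nat) (s : qbasis N M #|{: input N M}|) :
    qbasis N M #|{: input N M}| :=
  let: (i, z, w) := s in (ordS i, enum_val w i, enum_rank (upd (enum_val w) i z)).

Lemma store_step_inj (N M : nat) : injective (@store_step N M).
Proof.
move=> [[i z] w] [[j z'] w'] h.
have /= /ordS_inj ei := congr1 (fun s => s.1.1) h; subst j.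
have /= ez := congr1 (fun s => s.1.2) h.
have /= /enum_rank_inj /ffunP eu := congr1 snd h.
have -> : z = z' by have := eu i; rewrite !ffunE eqxx.
congr (_, _, _); apply: enum_val_inj; apply/ffunP => l.
have := eu l; rewrite !ffunE; case: eqP => [-> _|//]; exact: ez.
Qed.

(** Reading the whole input shows that the set defining [Qquery] is nonempty, so that its infimum is
    attained. *)
Lemma q_computes_N (N M : nat) (f : pfun N M) : (0 < N)%N -> (0 < M)%N -> q_computes f N.
Proof.
case: N f => // N f _ M0; pose z0 : 'I_M := Ordinal M0.
pose part (X : input N.+1 M) (k : nat) : input N.+1 M :=
  [ffun j : 'I_N.+1 => if (j < k)%N then X j else z0].
(* The state after $k$ rounds: the first $k$ values are stored and unread cells hold [z0]. As [z0]
   is the zero of the register, swapping with an unread cell resets the answer register for the next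
   query. *)
pose st X k : qbasis N.+1 M _ := (iter k (@ordS _) (ord0 : 'I_N.+1), z0, enum_rank (part X k)).
pose U k := if k is 0 then 1%:M else perm_op (@store_step N.+1 M).
pose A := @QAlg N.+1 M N.+1 _ (st [ffun=> z0] 0) U
  (fun s => f (enum_val s.2) == Some true).
exists A; split.
  move=> [|k] _ /=; last exact/perm_op_unitary/store_step_inj.
  by apply/unitarymxP; rewrite mul1mx trmx1 map_mx1.
move=> X b fX.
have pos k : (k <= N)%N -> iter k (@ordS _) (ord0 : 'I_N.+1) = k :> nat.
  by elim: k => //= k IHk kN; rewrite (IHk (ltnW kN)) modn_small.
have stE k : (k <= N.+1)%N -> q_state A X k = basis_vec (st X k).
  elim: k => [_|k IHk kN] /=.
    rewrite mul1mx; congr basis_vec; congr (_, _, enum_rank _).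
  rewrite (IHk (ltnW kN)) oracleE !perm_op_basis; congr basis_vec.
  rewrite /st /= enum_rankK; set i := iter k _ _; have ik : i = k :> nat by apply: pos.
  congr (_, _, enum_rank _); first by rewrite ffunE ik ltnn.
  apply/ffunP => j; rewrite !ffunE ltnS [(j <= k)%N]leq_eqVlt.
  rewrite (_ : (j == k :> nat) = (j == i)); last by rewrite -ik.
  case: (j =P i) => [->|//] /=.
  by apply: val_inj; rewrite /= add0n modn_small.
rewrite /q_prob (bigD1 (st X N.+1)); last first.
  rewrite /= enum_rankK (_ : part X N.+1 = X) ?fX; first by case: (b).
  by apply/ffunP => j; rewrite ffunE ltn_ord.
rewrite stE // mxE enum_rankK eqxx normr1 expr1n.
apply: (@le_trans _ _ 1); last by rewrite lerDl sumr_ge0 // => s _; rewrite exprn_ge0.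
by rewrite ler_pdivrMr ?ltr0n // mul1r ler_nat.
Qed.

(** * The randomized algorithm *)

(** A nonadaptive algorithm. Repeated indices are queried again, so its cost is the same on all
    inputs; [X0] supplies defaults at unqueried positions. *)
Fixpoint query_tree (N M : nat) (g : input N M -> bool) (l : seq 'I_N) (X0 : input N M) :
    dtree N M :=
  if l is i :: l' then Node i (fun v => query_tree g l' (upd X0 i v)) else Leaf N M (g X0).

Lemma dt_out_query_tree (N M : nat) (g : input N M -> bool) (l : seq 'I_N) X0 X :
  dt_out (query_tree g l X0) X = g [ffun j => if j \in l then X j else X0 j].
Proof.
elim: l X0 => [|i l IHl] X0 /=; first by congr g; apply/ffunP => j; rewrite ffunE.
rewrite IHl; congr g; apply/ffunP => j; rewrite !ffunE inE.
by case: eqP => [->|]; case: ifP.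
Qed.

Lemma dt_cost_query_tree (N M : nat) (g : input N M -> bool) (l : seq 'I_N) X0 X :
  dt_cost (query_tree g l X0) X = size l.
Proof. by elim: l X0 => //= i l IHl X0; rewrite IHl. Qed.

Lemma Rquery_le (N M : nat) (f : pfun N M) (A : ralg N M) (c : R) :
  r_computes f A -> 0 <= c -> (forall X, r_ecost A X <= c) -> Rquery f <= c.
Proof.
move=> fA c0 hc; apply: (@le_trans _ _ (r_cost f A)); last first.
  by apply: bigmax_le => // X _.
apply: ge_inf; last by exists A.
(* Costs are maxima starting from 0, so the set is bounded below, as [ge_inf] requires. *)
by exists 0 => _ [B [_ <-]]; apply: bigmax_ge_id.
Qed.

Lemma Rquery_leN (N M : nat) (f : pfun N M) : (0 < M)%N -> Rquery f <= N%:R.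
Proof.
move=> M0; pose t := query_tree (fun X => f X == Some true) (enum 'I_N) [ffun=> Ordinal M0].
have tE X : dt_out t X = (f X == Some true).
  rewrite dt_out_query_tree (_ : [ffun=> _] = X) //.
  by apply/ffunP => j; rewrite ffunE mem_enum.
apply: (@Rquery_le _ _ _ [:: (1, t)]) => //.
- split; first by split=> [p [<-|//]|]; rewrite ?big_seq1 //= ler01.
  move=> X b fX; rewrite /r_prob big_cons big_nil /= tE fX.
  rewrite (_ : (Some b == Some true) == b); last by case: (b).
  by rewrite addr0; lra.
- by move=> X; rewrite /r_ecost big_seq1 /= mul1r dt_cost_query_tree size_enum_ord.
Qed.

Lemma In_map (S T : Type) (F : S -> T) (P : T -> Prop) (s : seq S) :
  (forall x, P (F x)) -> forall p, List.In p [seq F x | x <- s] -> P p.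
Proof. by move=> h p; elim: s => //= x s IHs [<-|/IHs]. Qed.

(** The error budget: passing from permutations to uniform maps with $h=288$ costs $9/288=3/96$, and
    passing to stick laws costs $1/24=4/96$. *)
Lemma perm_avg_bounds (N M : nat) (f : pfun N M) (A : input N M -> R) (k J : nat)
    (X : input N M) (al be s : R) :
  perm_invariant f -> degle k A -> (0 < k)%N -> (2 * 288 * k ^ 4 <= N)%N ->
  (forall Y, 0 <= A Y <= 1) -> 0 <= al <= 1 -> 0 <= be ->
  (forall Y, f Y = f X -> al <= A Y <= be) ->
  J = (192 ^ 3 * k ^ 8)%N -> s = ((192 ^ 2 * k ^ 6)%N%:R)^-1 ->
  al - 7 / 96 <= avg J
     (fun y => expect (fun C : {ffun 'I_N -> 'I_N} => A [ffun i => X (C i)]) (stick_law s y))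
    <= be + 7 / 96.
Proof.
move=> fI hA k0 kN A01 /andP[al0 al1] be0 Aab hJ hs.
have V0 : (0 < #|'I_N|)%N.
  by rewrite card_ord (leq_trans _ kN) // muln_gt0 expn_gt0 k0.
pose B (C : {ffun 'I_N -> 'I_N}) := A [ffun i => X (C i)].
have hB : degle k B := degle_comp X hA.
have B01 C : 0 <= B C <= 1 by apply: A01.
have := stick_law_uniform_24 V0 hB k0 B01 hJ hs; rewrite ler_norml.
have : al - 9 / 288%:R <= expect B (uniform R) <= be + 9 / 288%:R.
  apply: (@uniform_vs_injective _ _ _ k) => //; first by rewrite card_ord.
  (* An injective self-map is a permutation of the positions, so [f] takes the same value at $X\circ
     C$ as at $X$. *)
  move=> C CI; apply: Aab; rewrite (fI (perm CI) 1%g X); congr f.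
  by apply/ffunP => i; rewrite !ffunE perm1 permE.
by move=> /andP[? ?] /andP[? ?]; apply/andP; split; lra.
Qed.

(** The algorithm draws a word [y] of $J$ uniform positions, queries them and compares with $1/2$
    the mean [E y X], which depends only on the answers. *)
Lemma Rquery_large_N (N M : nat) (f : pfun N M) (A : input N M -> R) (k J : nat) :
  perm_invariant f -> degle k A -> (0 < k)%N -> (0 < M)%N -> (2 * 288 * k ^ 4 <= N)%N ->
  (forall X, 0 <= A X <= 1) ->
  (forall X, (f X = Some true -> 92 / 100 <= A X) /\ (f X = Some false -> A X <= 8 / 100)) ->
  J = (192 ^ 3 * k ^ 8)%N -> Rquery f <= J%:R.
Proof.
move=> fI hA k0 M0 kN A01 Af hJ.
have N0 : (0 < N)%N by apply: leq_trans kN; rewrite muln_gt0 expn_gt0 k0.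
have V0 : (0 < #|'I_N|)%N by rewrite card_ord.
have J0 : (0 < J)%N by rewrite hJ muln_gt0 !expn_gt0 k0.
pose X0 : input N M := [ffun=> Ordinal M0].
have [s hs] : exists s : R, s = ((192 ^ 2 * k ^ 6)%N%:R)^-1 by eexists.
have s01 : 0 < s <= 1.
  have h : (0 < 192 ^ 2 * k ^ 6)%N by rewrite muln_gt0 !expn_gt0 k0.
  by rewrite hs invr_gt0 ltr0n h invf_le1 ?ltr0n // ler1n.
pose E (y : seq 'I_N) (X : input N M) : R :=
  expect (fun C : {ffun 'I_N -> 'I_N} => A [ffun i => X (C i)]) (stick_law s y).
have E01 y X : size y = J -> 0 <= E y X <= 1.
  by move=> yJ; apply: expect_bounds => //; apply: is_prob_stick_law; rewrite ?yJ.
pose t y := query_tree (fun X => 1 / 2 <= E y X) y X0.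
have tE y X : dt_out (t y) X = (1 / 2 <= E y X).
  rewrite dt_out_query_tree; congr (_ <= _); apply: expect_stick_law_eq => j jy.
  by rewrite ffunE jy.
pose w : R := (#|'I_N|%:R ^+ J)^-1.
pose Alg : ralg N M := [seq (w, t y) | y <- words 'I_N J].
have wE (g : seq 'I_N -> R) : \sum_(y <- words 'I_N J) w * g y = avg J g.
  by rewrite -mulr_sumr mulrC.
have w1 : avg J (fun _ : seq 'I_N => 1) = 1 :> R by apply: avg1.
apply: (@Rquery_le _ _ _ Alg); first last.
- move=> X; rewrite /r_ecost big_map (eq_big_seq (fun y => (w * 1) * J%:R)) /=.
    by rewrite -mulr_suml (wE (fun=> 1)) w1 mul1r.
  by move=> y /size_words yJ; rewrite dt_cost_query_tree yJ mulr1.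
- by rewrite ler0n.
split.
  split; first by apply: In_map => y /=; rewrite invr_ge0 exprn_ge0.
  by rewrite big_map -[RHS]w1 -wE; apply: eq_bigr => y _; rewrite mulr1.
move=> X b fX.
have pE : r_prob Alg X b = avg J (fun y => ((1 / 2 <= E y X) == b)%:R).
  rewrite -wE /r_prob big_map big_mkcond; apply: eq_bigr => y _ /=.
  by rewrite tE; case: (_ == b); rewrite ?mulr1 ?mulr0.
rewrite pE; case: b fX {pE} => fX.
- have a01 : 0 <= (92 / 100 : R) <= 1 by apply/andP; split; lra.
  have AX Y : f Y = f X -> 92 / 100 <= A Y <= 1.
    by rewrite fX => /(proj1 (Af Y)) ->; case/andP: (A01 Y).
  have /andP[h _] := perm_avg_bounds fI hA k0 kN A01 a01 ler01 AX hJ hs.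
  (* A form of Markov's inequality: on $[0,1]$ the indicator of $E\ge1/2$ dominates $2E-1$, whose
     average is at least $2(92/100-7/96)-1>2/3$. The case [false] is symmetric, with $1-2E$. *)
  apply: (@le_trans _ _ (avg J (fun y => - 1 + 2 * E y X))).
    by rewrite avg_affine // /E; lra.
  apply: ler_avg => y yJ; have /andP[e0 e1] := E01 y X yJ.
  by case: (leP (1 / 2) (E y X)) => /= h2; lra.
- have a01 : 0 <= (8 / 100 : R) by lra.
  have b01 : 0 <= (0 : R) <= 1 by rewrite lexx ler01.
  have AX Y : f Y = f X -> 0 <= A Y <= 8 / 100.
    by rewrite fX => /(proj2 (Af Y)) ->; case/andP: (A01 Y) => ->.
  have /andP[_ h] := perm_avg_bounds fI hA k0 kN A01 b01 a01 AX hJ hs.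
  apply: (@le_trans _ _ (avg J (fun y => 1 + (-2) * E y X))).
    by rewrite avg_affine // /E; lra.
  apply: ler_avg => y yJ; have /andP[e0 e1] := E01 y X yJ.
  by case: (leP (1 / 2) (E y X)) => /= h2; lra.
Qed.

Theorem theorem5 :
  exists (c : R) (k : nat), 0 < c /\
    forall (N M : nat), (0 < N)%N -> (0 < M)%N ->
    forall f : pfun N M, perm_invariant f ->
      Rquery f <= c * (Qquery f + 1) ^+ 9 * (ln (Qquery f + 2)) ^+ k.
Proof.
(* The constant is $J=192^3k^8$ at $k=54(T+1)$ with $(T+1)^8$ removed; the eighth power leaves room
   for a logarithmic exponent 0. *)
exists (192 ^+ 3 * 54 ^+ 8), 0%N; split; first by rewrite mulr_gt0 ?exprn_gt0 // ltr0n.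
move=> N M N0 M0 f fI; rewrite expr0 mulr1.
have [T TQ hT] : exists2 T : nat, T%:R <= Qquery f & q_computes f T.
  have ex : exists n, `[< q_computes f n >].
    by exists N; apply/asboolP/q_computes_N.
  case: (ex_minnP ex) => T /asboolP hT Tmin; exists T => //.
  apply: lb_le_inf; first by exists T%:R, T.
  by move=> _ [n hn <-]; rewrite ler_nat Tmin //; apply/asboolP.
have [A [hA A01 Af]] := q_computes_poly hT.
(* Taking $T+1$ keeps the degree bound positive when $T=0$. *)
pose k := (54 * T.+1)%N; have k0 : (0 < k)%N by [].
have {}hA : degle k A by apply: degleW hA; rewrite leq_mul.
have [J hJ] : exists J, J = (192 ^ 3 * k ^ 8)%N by eexists.
have RJ : Rquery f <= J%:R.
  (* Below the threshold, querying all $N<576k^4\le J$ positions is cheap enough. *)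
  have [Nk|kN] := ltnP N (2 * 288 * k ^ 4); last exact: (Rquery_large_N fI hA k0 M0 kN A01 Af hJ).
  apply: le_trans (Rquery_leN f M0) _; rewrite ler_nat (leq_trans (ltnW Nk)) // hJ.
  rewrite leq_mul ?leq_pexp2l // (_ : 2 * 288 = 3 * 192)%N // (expnSr 192 2) leq_mul.
apply: le_trans RJ _.
have -> : J%:R = 192 ^+ 3 * 54 ^+ 8 * (T%:R + 1) ^+ 8 :> R.
  by rewrite hJ natrM !natrX natrM exprMn mulrA natr1.
rewrite ler_wpM2l ?mulr_ge0 ?exprn_ge0 //.
have T1 : 1 <= T%:R + 1 :> R by rewrite lerDr ler0n.
apply: (@le_trans _ _ ((T%:R + 1) ^+ 9)); first by rewrite ler_weXn2l.
by rewrite lerXn2r ?nnegrE ?lerD2r //; lra.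
Qed.
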